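(* Let $G=(S_1,S_2,A_1,A_2,p,F)$ be a leaktight half-blind game with initial state $s\in S_1$. The belief monoid algorithm, which computes the finite set $\mathcal{B}$ (the belief monoid of $G$) by closing its generators under product and iteration and returns true if and only if $\mathcal{B}$ contains a reachability witness, correctly solves the maxmin reachability problem for $G$. That is, $\mathcal{B}$ contains a reachability witness if and only if $$\sup_{w\in\Sigma_1}\ \inf_{\tau\in\Sigma_2}\ \mathbb{P}_s^{w,\tau}(F)=1 .$$
   Context: **Half-blind games.** A half-blind game is a tuple $G=(S_1,S_2,A_1,A_2,p,F)$ where $S_1,S_2$ are finite disjoint sets of states (controlled by Player 1, the maximizer, and Player 2, the minimizer), $A_1,A_2$ are finite disjoint nonempty sets of actions, $p$ maps $S_1\times A_1$ to $\Delta(S_2)$ and $S_2\times A_2$ to $\Delta(S_1)$ ($\Delta(X)$ is the set of probability distributions on $X$), and $F\subseteq S_1$ is the set of final states. The maximizer's strategies are finite words: $\Sigma_1=A_1^*$. The minimizer's strategies $\Sigma_2$ are all functions $\tau:(S_1A_1S_2A_2)^*S_1A_1S_2\to\Delta(A_2)$. For $w=a_1\cdots a_n\in\Sigma_1$, $\tau\in\Sigma_2$, $s\in S_1$, the measure $\mathbb{P}_s^{w,\tau}$ on $(S_1A_1S_2A_2)^nS_1$ gives to $h=s_1a_1t_1b_1\cdots s_na_nt_nb_ns_{n+1}$ with $s_1=s$ the probability $\prod_{i=1}^n p(s_i,a_i)(t_i)\,\tau(h_i)(b_i)\,p(t_i,b_i)(s_{i+1})$, $h_i=s_1a_1t_1b_1\cdots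 s_ia_it_i$, and probability $0$ to histories whose initial state is not $s$ or whose $A_1$-letters do not spell $w$. $\mathbb{P}_s^{w,\tau}(t)$ is the probability that the last state $s_{n+1}$ is $t$, and $\mathbb{P}_s^{w,\tau}(R)=\sum_{t\in R}\mathbb{P}_s^{w,\tau}(t)$ for $R\subseteq S_1$. $\Sigma_2^p$ is the set of functions $\tau:\{1,2,\dots\}\to(S_2\to A_2)$, regarded as strategies playing deterministically $\tau(i)(t_i)$ at turn $i$ in state $t_i$. **Binary matrices.** For $S_1\times S_1$ binary matrices, the product is the Boolean product: $UV(s,t)=1$ iff there is $s'$ with $U(s,s')=1$ and $V(s',t)=1$. For a binary matrix $U$, a state $t$ is $U$-recurrent if for all $t'$, $U(t,t')=1$ implies $U(t',t)=1$. For idempotent $U$ ($U^2=U$), the iteration $U^\#$ is defined by $U^\#(s,t)=1$ iff $U(s,t)=1$ and $t$ is $U$-recurrent. For a set $X$ of elements with a product and an iteration defined on idempotents, $\langle X\rangle$ is the smallest set containing $X$ closed under product and under iteration of its idempotents. For $a\in A_1$, $\tau\in\Sigma_2^p$, $B^{a,\tau}$ is the binary matrix with $B^{a,\tau}(s,t)=1$ iff $\mathbb{P}_s^{a,\tau}(t)>0$. $\mathbf 1$ is the identity matrix. **Markov and belief monoids.** The Markov monoid is $\mathcal{M}=\langle\{B^{a,\tau}\mid a\in A_1,\tau\in\Sigma_2^p\}\cup\{\mathbf 1\}\rangle$. For $\mathbf u,\mathbf v\subseteq\mathcal{M}$: $\mathbf u\mathbf v=\{UV\mid U\in\mathbf u,V\in\mathbf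 v\}$; and if $\mathbf u\mathbf u=\mathbf u$, $\mathbf u^\#=\langle\{UE^\#V\mid U,E,V\in\mathbf u,\ EE=E\}\rangle$. With $\mathbf a=\{B^{a,\tau}\mid\tau\in\Sigma_2^p\}$, the belief monoid $\mathcal{B}$ is the smallest subset of $2^{\mathcal{M}}$ containing $\{\mathbf a\mid a\in A_1\}\cup\{\{\mathbf 1\}\}$ and closed under product and under iteration of idempotents. An element $\mathbf u\in\mathcal{B}$ is a reachability witness if for all $U\in\mathbf u$ and $t\in S_1$, $U(s,t)=1$ implies $t\in F$, where $s$ is the initial state. **Extended monoids and leaktightness.** On pairs of binary matrices put $(U,\widetilde U)(V,\widetilde V)=(UV,\widetilde U\widetilde V)$ and, for idempotent pairs, $(E,\widetilde E)^\#=(E^\#,\widetilde E)$. The extended Markov monoid $\widetilde{\mathcal{M}}$ is the smallest set of pairs containing all $(B^{a,\tau},B^{a,\tau})$ ($a\in A_1,\tau\in\Sigma_2^p$) and $(\mathbf 1,\mathbf 1)$, closed under product and iteration. The extended belief monoid $\widetilde{\mathcal{B}}\subseteq 2^{\widetilde{\mathcal{M}}}$ is defined exactly as $\mathcal{B}$, with $\widetilde{\mathcal{M}}$ in place of $\mathcal{M}$, generators $\{(B^{a,\tau},B^{a,\tau})\mid\tau\in\Sigma_2^p\}$ ($a\in A_1$) and $\{(\mathbf 1,\mathbf 1)\}$, and the same set-product and set-iteration. An element $(U,\widetilde U)\in\widetilde{\mathcal{M}}$ is a leak if it is idempotent and there are $U$-recurrent states $r,r'\in S_1$ with $U(r,r')=0$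 and $\widetilde U(r,r')=1$. An element of $\widetilde{\mathcal{B}}$ is a leak if it contains a leak. The game is leaktight if $\widetilde{\mathcal{B}}$ contains no leak. *)

(* Defs.v *)
From mathcomp Require Import all_boot all_order all_algebra.
From mathcomp Require Import all_classical all_reals.

Set Implicit Arguments.
Unset Strict Implicit.
Unset Printing Implicit Defensive.

Import Order.TTheory GRing.Theory Num.Theory.
Local Open Scope ring_scope.
Local Open Scope set_scope.

Section Distributions.
Variables (R : realType) (X : finType).

Record dist := Dist {
  dist_fun :> X -> R;
  dist_ge0 : forall x, 0 <= dist_fun x;
  dist_sum1 : \sum_x dist_fun x = 1
}.

Lemma point_ge0 (x0 x : X) : 0 <= (x == x0)%:R :> R.
Proof. exact: ler0n. Qed.

Lemma point_sum1 (x0 : X) : \sum_x (x == x0)%:R = 1 :> R.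
Proof.
by rewrite (bigD1 x0) //= eqxx big1 ?addr0 // => x /negPf ->.
Qed.

Definition point_dist (x0 : X) : dist :=
  Dist (point_ge0 x0) (point_sum1 x0).

End Distributions.

(* The disjoint sets of states and of actions are modelled by distinct types;
   [trans1] and [trans2] are the two parts of the transition function p. *)
Record half_blind_game (R : realType) := HalfBlindGame {
  S1 : finType;
  S2 : finType;
  A1 : finType;
  A2 : finType;
  A1_nonempty : (0 < #|A1|)%N;
  A2_nonempty : (0 < #|A2|)%N;
  trans1 : S1 -> A1 -> dist R S2;
  trans2 : S2 -> A2 -> dist R S1;
  final : {set S1}
}.

Section Play.
Variables (R : realType) (G : half_blind_game R).

Definition round := (S1 G * A1 G * S2 G * A2 G)%type.

Definition rstate1 (x : round) : S1 G := x.1.1.1.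
Definition ract1 (x : round) : A1 G := x.1.1.2.
Definition rstate2 (x : round) : S2 G := x.1.2.
Definition ract2 (x : round) : A2 G := x.2.

Definition word := seq (A1 G).

(* Elements of (S1 A1 S2 A2)^* S1 A1 S2. *)
Definition partial_history := (seq round * S1 G * A1 G * S2 G)%type.

Definition strategy2 := partial_history -> dist R (A2 G).

(* Turns are counted from 0: [tau i] is the choice made at turn i + 1. *)
Definition pure_strategy2 := nat -> S2 G -> A2 G.

Definition strategy_of_pure (tau : pure_strategy2) : strategy2 :=
  fun h => point_dist R (tau (size h.1.1.1) h.2).

Definition history (n : nat) := (n.-tuple round * S1 G)%type.

(* [state_at h i] is s_(i+1); for i = n it is the last state of h, which is the
   default value of [nth]. *)
Definition state_at n (h : history n) (i : nat) : S1 G :=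
  nth h.2 (map rstate1 h.1) i.

Definition history_prefix n (h : history n) (i : 'I_n) : partial_history :=
  let x := tnth h.1 i in (take i h.1, rstate1 x, ract1 x, rstate2 x).

Definition history_prob (s : S1 G) (w : word) (tau : strategy2)
    (h : history (size w)) : R :=
  if (state_at h 0 == s) && (map ract1 h.1 == w) then
    \prod_(i < size w)
      (let x := tnth h.1 i in
       trans1 (rstate1 x) (ract1 x) (rstate2 x)
       * tau (history_prefix h i) (ract2 x)
       * trans2 (rstate2 x) (ract2 x) (state_at h i.+1))
  else 0.

Definition prob_at (s : S1 G) (w : word) (tau : strategy2) (t : S1 G) : R :=
  \sum_(h : history (size w) | h.2 == t) history_prob s tau h.

Definition prob_in (s : S1 G) (w : word) (tau : strategy2) (T : {set S1 G}) : R :=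
  \sum_(t in T) prob_at s w tau t.

Definition maxmin_value (s : S1 G) : R :=
  sup (range (fun w : word =>
    inf (range (fun tau : strategy2 => prob_in s w tau (final G))))).

End Play.

(* [mul] and [sharp] are a product and an iteration on T; [sharp] is only
   meaningful, and only applied, on idempotents. *)
Section Closure.
Variables (T : finType) (mul : T -> T -> T) (sharp : T -> T).

Definition idempotent_elt (x : T) := mul x x == x.

Definition stable (Y : {set T}) : bool :=
  [forall x in Y, forall y in Y, mul x y \in Y]
  && [forall x in Y, idempotent_elt x ==> (sharp x \in Y)].

Definition generated (X : {set T}) : {set T} :=
  \bigcap_(Y : {set T} | (X \subset Y) && stable Y) Y.

Definition set_mul (u v : {set T}) : {set T} := mul @2: (u, v).

Definition sandwich (u : {set T}) : {set T} :=
  set_mul (set_mul u (sharp @: [set e in u | idempotent_elt e])) u.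

Definition set_sharp (u : {set T}) : {set T} := generated (sandwich u).

(* Saturation procedure: every pass that is not the last one adds an element,
   so #|T| passes are enough. *)
Definition close_step (Y : {set T}) : {set T} :=
  Y :|: set_mul Y Y :|: sharp @: [set e in Y | idempotent_elt e].

Definition saturate (X : {set T}) : {set T} := iter #|T| close_step X.

Definition saturate_sharp (u : {set T}) : {set T} := saturate (sandwich u).

End Closure.

Section BinaryMatrices.
Variable S : finType.

Definition bmx := {ffun S * S -> bool}.

Definition bmx_one : bmx := [ffun st => st.1 == st.2].

Definition bmx_mul (U V : bmx) : bmx :=
  [ffun st => [exists s', U (st.1, s') && V (s', st.2)]].

Definition recurrent (U : bmx) (t : S) : bool :=
  [forall t', U (t, t') ==> U (t', t)].

Definition bmx_sharp (U : bmx) : bmx :=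
  [ffun st => U st && recurrent U st.2].

Definition bmx2 := (bmx * bmx)%type.

Definition bmx2_mul (x y : bmx2) : bmx2 := (bmx_mul x.1 y.1, bmx_mul x.2 y.2).

Definition bmx2_sharp (x : bmx2) : bmx2 := (bmx_sharp x.1, x.2).

Definition leak (x : bmx2) : bool :=
  idempotent_elt bmx2_mul x &&
  [exists r, exists r',
    [&& recurrent x.1 r, recurrent x.1 r', ~~ x.1 (r, r') & x.2 (r, r')]].

End BinaryMatrices.

Section Monoids.
Variables (R : realType) (G : half_blind_game R).

Definition action_bmx (a : A1 G) (tau : pure_strategy2 G) : bmx (S1 G) :=
  [ffun st => 0 < prob_at st.1 [:: a] (strategy_of_pure tau) st.2].

Definition action_belief (a : A1 G) : {set bmx (S1 G)} :=
  [set U | `[< exists tau : pure_strategy2 G, U = action_bmx a tau >]].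

Definition markov_monoid : {set bmx (S1 G)} :=
  generated (@bmx_mul _) (@bmx_sharp _)
    ((\bigcup_(a : A1 G) action_belief a) :|: [set bmx_one (S1 G)]).

(* The closure is taken among all sets of matrices; as [powerset markov_monoid]
   contains the generators and is stable, the result is the smallest such subset
   of [powerset markov_monoid] (see [belief_monoid_sub]). *)
Definition belief_monoid : {set {set bmx (S1 G)}} :=
  generated (set_mul (@bmx_mul _)) (set_sharp (@bmx_mul _) (@bmx_sharp _))
    ([set action_belief a | a : A1 G] :|: [set [set bmx_one (S1 G)]]).

Definition reachability_witness (s : S1 G) (u : {set bmx (S1 G)}) : Prop :=
  forall U t, U \in u -> U (s, t) -> t \in final G.

Definition ext_action_belief (a : A1 G) : {set bmx2 (S1 G)} :=
  [set x | `[< exists tau : pure_strategy2 G,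
                 x = (action_bmx a tau, action_bmx a tau) >]].

Definition ext_one : bmx2 (S1 G) := (bmx_one (S1 G), bmx_one (S1 G)).

Definition ext_markov_monoid : {set bmx2 (S1 G)} :=
  generated (@bmx2_mul _) (@bmx2_sharp _)
    ((\bigcup_(a : A1 G) ext_action_belief a) :|: [set ext_one]).

Definition ext_belief_monoid : {set {set bmx2 (S1 G)}} :=
  generated (set_mul (@bmx2_mul _)) (set_sharp (@bmx2_mul _) (@bmx2_sharp _))
    ([set ext_action_belief a | a : A1 G] :|: [set [set ext_one]]).

Definition belief_leak (u : {set bmx2 (S1 G)}) : Prop :=
  exists2 x, x \in u & leak x.

Definition leaktight : Prop :=
  forall u, u \in ext_belief_monoid -> ~ belief_leak u.

(* The matrix [action_bmx a tau] only depends on the first choice of [tau], so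
   the algorithm enumerates the finitely many functions from S2 to A2. *)
Definition computed_action_belief (a : A1 G) : {set bmx (S1 G)} :=
  [set action_bmx a (fun=> sigma) | sigma : {ffun S2 G -> A2 G}].

Definition computed_belief_monoid : {set {set bmx (S1 G)}} :=
  saturate (set_mul (@bmx_mul _)) (saturate_sharp (@bmx_mul _) (@bmx_sharp _))
    ([set computed_action_belief a | a : A1 G] :|: [set [set bmx_one (S1 G)]]).

Definition belief_monoid_algorithm (s : S1 G) : bool :=
  [exists u in computed_belief_monoid,
    [forall U in u, forall t, U (s, t) ==> (t \in final G)]].

End Monoids.

Section BeliefSub.
Variables (T : finType) (mul : T -> T -> T) (sharp : T -> T).

Lemma generated_sub (X : {set T}) : X \subset generated mul sharp X.
Proof. by apply/finset.bigcapsP => Y /andP[]. Qed.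

Lemma generated_min (X Y : {set T}) :
  X \subset Y -> stable mul sharp Y -> generated mul sharp X \subset Y.
Proof. by move=> XY sY; apply: (finset.bigcap_inf Y); rewrite XY. Qed.

Lemma generated_stable (X : {set T}) : stable mul sharp (generated mul sharp X).
Proof.
apply/andP; split.
  apply/forall_inP => x /finset.bigcapP Hx; apply/forall_inP => y /finset.bigcapP Hy.
  apply/finset.bigcapP => Y HY; have /andP[_ /andP[/forall_inP sY _]] := HY.
  by move/forall_inP: (sY _ (Hx _ HY)); apply; exact: Hy.
apply/forall_inP => x /finset.bigcapP Hx; apply/implyP => ix.
apply/finset.bigcapP => Y HY; have /andP[_ /andP[_ /forall_inP sY]] := HY.
exact: (implyP (sY _ (Hx _ HY))).
Qed.

Lemma powerset_stable (M : {set T}) : stable mul sharp M ->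
  stable (set_mul mul) (set_sharp mul sharp) (powerset M).
Proof.
move=> sM; have /andP[/forall_inP mM /forall_inP iM] := sM.
have mulS (u v : {set T}) : u \subset M -> v \subset M -> set_mul mul u v \subset M.
  move=> /fintype.subsetP uM /fintype.subsetP vM; apply/fintype.subsetP => _ /imset2P[x y xu yv ->].
  by move/forall_inP: (mM _ (uM _ xu)); apply; exact: vM.
apply/andP; split.
  apply/forall_inP => u; rewrite inE => uM; apply/forall_inP => v; rewrite inE => vM.
  by rewrite inE mulS.
apply/forall_inP => u; rewrite inE => uM; apply/implyP => _; rewrite inE.
apply: generated_min => //; rewrite !mulS //.
apply/fintype.subsetP => _ /imsetP[e + ->]; rewrite inE => /andP[eu ie].
by apply: (implyP (iM _ _)) => //; exact: (fintype.subsetP uM).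
Qed.

End BeliefSub.

Lemma belief_monoid_sub (R : realType) (G : half_blind_game R) :
  belief_monoid G \subset powerset (markov_monoid G).
Proof.
apply: generated_min; last by apply: powerset_stable; exact: generated_stable.
have gS := generated_sub (@bmx_mul _) (@bmx_sharp _)
  ((\bigcup_(a : A1 G) action_belief a) :|: [set bmx_one (S1 G)]).
rewrite finset.subUset; apply/andP; split.
  apply/fintype.subsetP => _ /imsetP[a _ ->]; rewrite inE; apply: fintype.subset_trans gS.
  by apply: fintype.subset_trans (finset.subsetUl _ _); exact: (finset.bigcup_sup a).
rewrite finset.sub1set inE; apply: fintype.subset_trans gS; exact: finset.subsetUr.
Qed.

Lemma ext_belief_monoid_sub (R : realType) (G : half_blind_game R) :
  ext_belief_monoid G \subset powerset (ext_markov_monoid G).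
Proof.
apply: generated_min; last by apply: powerset_stable; exact: generated_stable.
have gS := generated_sub (@bmx2_mul _) (@bmx2_sharp _)
  ((\bigcup_(a : A1 G) ext_action_belief a) :|: [set ext_one G]).
rewrite finset.subUset; apply/andP; split.
  apply/fintype.subsetP => _ /imsetP[a _ ->]; rewrite inE; apply: fintype.subset_trans gS.
  by apply: fintype.subset_trans (finset.subsetUl _ _); exact: (finset.bigcup_sup a).
rewrite finset.sub1set inE; apply: fintype.subset_trans gS; exact: finset.subsetUr.
Qed.

(* Main.v *)
(** Soundness and completeness both evaluate long products of stochastic kernels
    along factorization trees of bounded height (Simon's theorem).  Leaktightness
    yields the one estimate that is uniform in the number of factors: in a product
    of kernels that are supported by [W] and at least [d] on an idempotent [E],
    the entries in [E^#] are at least [d^2], because what leaves an [E]-recurrent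
    class along [W] comes back to it with probability [d].

    Completeness: for every word there is an element [u] of the extended belief
    monoid all of whose matrices are realized, with a lower bound depending only on
    the height of the tree, by some strategy of Player 2; hence if the word has
    value close enough to 1, then the projection of [u] is a reachability witness.

    Soundness: by induction, every belief [u] has, for each [eps], a word such that
    against each pure strategy some [U] in [u] bounds the outcome from above up to
    [eps].  For the iteration the word is repeated [N] times.  Each factor carries,
    besides [U], a matrix [V] contained in [U] with entries bounded below uniformly.
    At an iterated idempotent, [V] is always replaced by [V^#], but [U] by [U^#]
    only if there are more than [n] factors; [V] being tight, the mass escapes from
    the [U]-transient states at a rate independent of [n].  As the height is
    bounded, [N > n^H] forces some [U^#] to occur. *)

Require Import Defs.
From mathcomp Require Import all_boot all_order all_algebra.
From mathcomp Require Import all_classical all_reals.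
From mathcomp Require Import ring lra zify.

Set Implicit Arguments.
Unset Strict Implicit.
Unset Printing Implicit Defensive.

Import Order.TTheory GRing.Theory Num.Theory.
Local Open Scope ring_scope.

(** * Factorization trees *)

Section Factorization.
Variables (M : finType) (mul : M -> M -> M) (one : M).
Hypothesis mulA : associative mul.
Hypothesis mul1 : left_id one mul.
Hypothesis mulr1 : right_id one mul.

(** The size of the two-sided ideal of [x] stands for its Green J-class: it never grows under
    multiplication, and equality yields the converse divisibility. *)
Definition ideal_size (x : M) : nat := #|[set mul (mul p.1 x) p.2 | p : M * M]|.

Local Notation sz := ideal_size.

Lemma ideal_size_mul (a x b : M) : (sz (mul (mul a x) b) <= sz x)%N.
Proof.
apply: subset_leq_card; apply/fintype.subsetP => _ /imsetP[[c d] _ ->] /=.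
by apply/imsetP; exists (mul c a, mul b d) => //=; rewrite !mulA.
Qed.

Lemma ideal_size_mull (a x : M) : (sz (mul a x) <= sz x)%N.
Proof. by rewrite -[mul a x]mulr1; exact: ideal_size_mul. Qed.

Lemma ideal_size_mulr (x b : M) : (sz (mul x b) <= sz x)%N.
Proof. by rewrite -[x in mul x b]mul1; exact: ideal_size_mul. Qed.

Lemma ideal_size_le (x : M) : (sz x <= #|M|)%N.
Proof. exact: max_card. Qed.

Lemma ideal_size_eq_mul (a x b : M) :
  sz (mul (mul a x) b) = sz x ->
  exists c d, x = mul (mul c (mul (mul a x) b)) d.
Proof.
move=> e; set y := mul (mul a x) b in e *.
suff: x \in [set mul (mul p.1 y) p.2 | p : M * M].
  by case/imsetP => -[c d] _ ->; exists c, d.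
have /setP -> : [set mul (mul p.1 y) p.2 | p : M * M]
   = [set mul (mul p.1 x) p.2 | p : M * M].
  apply/eqP; rewrite eqEcard -/(sz x) -/(sz y) e leqnn andbT.
  apply/fintype.subsetP => _ /imsetP[[c d] _ ->] /=.
  by apply/imsetP; exists (mul c a, mul b d) => //=; rewrite /y !mulA.
by apply/imsetP; exists (one, one) => //=; rewrite mul1 mulr1.
Qed.

(* The left ideals of [x] and of [mul a x] are nested and of the same size. *)
Lemma stable_left (a x : M) : sz (mul a x) = sz x -> exists c, x = mul c (mul a x).
Proof.
move=> e; have e' : sz (mul (mul a x) one) = sz x by rewrite mulr1.
have [c [d xE]] := ideal_size_eq_mul e'; rewrite mulr1 in xE.
pose L z := [set mul p z | p : M].
have LS : L (mul a x) \subset L x.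
  apply/fintype.subsetP => _ /imsetP[p _ ->]; apply/imsetP; by exists (mul p a) => //=; rewrite mulA.
have xL : x \in L x by apply/imsetP; exists one => //; rewrite mul1.
suff /eqP E : L (mul a x) == L x.
  by move: xL; rewrite -E => /imsetP[p _ xp]; exists p.
rewrite eqEcard LS /=.
(* Every [mul p x] equals [mul (mul (mul p c) (mul a x)) d], so right multiplication by [d] maps the
   left ideal of [mul a x] onto a superset of that of [x]. *)
apply: leq_trans (leq_imset_card (fun z => mul z d) _).
apply: subset_leq_card; apply/fintype.subsetP => _ /imsetP[p _ ->].
apply/imsetP; exists (mul (mul p c) (mul a x)).
  by apply/imsetP; exists (mul p c).
by rewrite /= [in LHS]xE !mulA.
Qed.

Lemma stable_right (x b : M) : sz (mul x b) = sz x -> exists c, x = mul (mul x b) c.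
Proof.
move=> e; have e' : sz (mul (mul one x) b) = sz x by rewrite mul1.
have [c [d xE]] := ideal_size_eq_mul e'; rewrite mul1 in xE.
pose L z := [set mul z p | p : M].
have LS : L (mul x b) \subset L x.
  apply/fintype.subsetP => _ /imsetP[p _ ->]; apply/imsetP; by exists (mul b p) => //=; rewrite mulA.
have xL : x \in L x by apply/imsetP; exists one => //; rewrite mulr1.
suff /eqP E : L (mul x b) == L x.
  by move: xL; rewrite -E => /imsetP[p _ xp]; exists p.
rewrite eqEcard LS /=.
apply: leq_trans (leq_imset_card (fun z => mul c z) _).
apply: subset_leq_card; apply/fintype.subsetP => _ /imsetP[p _ ->].
apply/imsetP; exists (mul (mul x b) (mul d p)).
  by apply/imsetP; exists (mul d p).
by rewrite /= [in LHS]xE !mulA.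
Qed.

(** Equal sizes make [e] a right multiple [mul y c]; then [y = mul y e = mul (mul y y) c = mul y c =
    e]. *)
Lemma ideal_size_drop (e y : M) :
  mul e y = y -> mul y e = y -> mul y y = y -> y = e \/ (sz y < sz e)%N.
Proof.
move=> ey ye yy; have [lt|ge] := ltnP (sz y) (sz e); [by right|left].
have szE : sz (mul e y) = sz e.
  by apply/eqP; rewrite eqn_leq ideal_size_mulr ey.
have [c eE] := stable_right szE.
by rewrite ey in eE; rewrite -ye [in LHS]eE mulA yy -eE.
Qed.

(* [f] is a left multiple of [p] and a right multiple of [s], so that it is
   determined by fixing both. *)
Lemma same_type_factor (p s f g : M) :
  sz f = sz p -> sz g = sz p -> sz s = sz p ->
  mul p f = p -> mul f s = s -> mul p g = p -> mul g s = s ->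
  mul f f = f /\ f = g.
Proof.
move=> fp gp sp pf fs pg gs.
have factL h : sz h = sz p -> mul p h = p -> exists c, h = mul c p.
  by move=> hp ph; rewrite -ph; apply: stable_left; rewrite ph hp.
have factR h : sz h = sz p -> mul h s = s -> exists c, h = mul s c.
  by move=> hp hs; rewrite -hs; apply: stable_right; rewrite hs hp sp.
have [c fE] := factL _ fp pf; have [d fE'] := factR _ fp fs.
have [c' gE] := factL _ gp pg.
split; first by rewrite {1}fE -mulA pf.
have: mul g f = f by rewrite fE' mulA gs.
by rewrite {1}gE -mulA pf -gE => ->.
Qed.

(** * Trees of height [h] over a word, with an abstract labelling [T] *)

Section Trees.
Variables (A : Type) (T : nat -> seq A -> M -> Prop).

Inductive iterate (h : nat) (e : M) : nat -> seq A -> Prop :=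
| Iterate1 v : T h v e -> iterate h e 1 v
| IterateS v m w : T h v e -> iterate h e m w -> iterate h e m.+1 (v ++ w).

Lemma iterate_rcons h e m v w :
  iterate h e m w -> T h v e -> iterate h e m.+1 (w ++ v).
Proof.
elim=> {m w} [w Tw|v' m w Tv' _ IH] Tv; first by apply: IterateS => //; apply: Iterate1.
by rewrite -catA; apply: IterateS => //; apply: IH.
Qed.

Hypothesis T_mono : forall h w x, T h w x -> T h.+1 w x.
Hypothesis T_prod : forall h w w' x x',
  T h w x -> T h w' x' -> T h.+1 (w ++ w') (mul x x').
Hypothesis T_iter : forall h e m w,
  mul e e = e -> iterate h e m w ->
  exists y, [/\ T h.+1 w y, mul e y = y, mul y e = y & mul y y = y].

Lemma T_le h h' w x : (h <= h')%N -> T h w x -> T h' w x.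
Proof.
by move=> /subnK <-; elim: (_ - _)%N => //= n IH /IH; rewrite addSn; apply: T_mono.
Qed.

(** A word for which no tree is built yet is kept cut into trees whose labels have ideals smaller
    than [k]; the main induction decreases [k]. *)
Inductive blocks (h k : nat) : seq A -> Prop :=
| Blocks1 v x : T h v x -> (sz x < k)%N -> blocks h k v
| BlocksS v x w : T h v x -> (sz x < k)%N -> blocks h k w -> blocks h k (v ++ w).

Lemma blocks_le h h' k w : (h <= h')%N -> blocks h k w -> blocks h' k w.
Proof.
move=> hh; elim=> {w} [v x Tv xk|v x w Tv xk _ IH].
  exact: Blocks1 (T_le hh Tv) xk.
exact: BlocksS (T_le hh Tv) xk IH.
Qed.

Lemma blocks_cat h k w w' : blocks h k w -> blocks h k w' -> blocks h k (w ++ w').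
Proof.
move=> Bw Bw'; elim: Bw => {w} [v x Tv xk|v x w Tv xk _ IH].
  exact: BlocksS Tv xk Bw'.
by rewrite -catA; exact: BlocksS Tv xk IH.
Qed.

Lemma blocks_glueL h k v x w : T h v x -> blocks h k w -> blocks h.+1 k (v ++ w).
Proof.
move=> Tv; case=> {w} [v' x' Tv' xk|v' x' w Tv' xk Bw].
  apply: Blocks1 (T_prod Tv Tv') _; exact: leq_ltn_trans (ideal_size_mull _ _) xk.
rewrite catA; apply: BlocksS (T_prod Tv Tv') _ (blocks_le (leqnSn _) Bw).
exact: leq_ltn_trans (ideal_size_mull _ _) xk.
Qed.

Lemma blocks_glueR h k v x w : blocks h k w -> T h v x -> blocks h.+1 k (w ++ v).
Proof.
move=> Bw Tv; elim: Bw => {w} [v' x' Tv' xk|v' x' w Tv' xk _ IH].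
  apply: Blocks1 (T_prod Tv' Tv) _; exact: leq_ltn_trans (ideal_size_mulr _ _) xk.
by rewrite -catA; apply: BlocksS (T_mono Tv') xk IH.
Qed.

(** The label [x] is prescribed in the first alternative only; in the second, the smaller ideals are
    the progress. *)
Definition tree_or_blocks h k w x := T h w x \/ blocks h k w.

Lemma tree_or_blocks_le h h' k w x : (h <= h')%N ->
  tree_or_blocks h k w x -> tree_or_blocks h' k w x.
Proof. by move=> hh [/(T_le hh)|/(blocks_le hh)]; [left|right]. Qed.

Lemma tree_or_blocks_cat h k w x w' x' :
  tree_or_blocks h k w x -> tree_or_blocks h k w' x' ->
  tree_or_blocks h.+1 k (w ++ w') (mul x x').
Proof.
move=> [Tw|Bw] [Tw'|Bw'].
- by left; exact: T_prod.
- by right; exact: blocks_glueL Tw Bw'.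
- by right; exact: blocks_glueR Bw Tw'.
- by right; apply: blocks_cat; apply: blocks_le (leqnSn _) _.
Qed.

(* Folding a sequence of factors whose products are all [e]: the factors that
   admit a tree are iterated, the others already split into smaller blocks. *)
Inductive partial_iteration h k e : seq A -> Prop :=
| PartialTree m w : iterate h e m w -> partial_iteration h k e w
| PartialBlocks w : blocks h.+2 k w -> partial_iteration h k e w
| PartialBoth w1 m w2 : blocks h.+2 k w1 -> iterate h e m w2 ->
    partial_iteration h k e (w1 ++ w2).

Lemma partial_iteration1 h k e v :
  tree_or_blocks h k v e -> partial_iteration h k e v.
Proof.
case=> [Tv|Bv]; first exact: PartialTree (Iterate1 Tv).
by apply: PartialBlocks; apply: blocks_le Bv; rewrite -addn2 leq_addr.
Qed.

(** An iterated stretch followed by blocks is collapsed by [T_iter] into one tree and absorbed by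
    the first block. The height [h.+2] therefore does not grow with the number of factors. *)
Lemma partial_iteration_rcons h k e w v : mul e e = e ->
  partial_iteration h k e w -> tree_or_blocks h k v e ->
  partial_iteration h k e (w ++ v).
Proof.
move=> ee Pw [Tv|Bv].
  case: Pw => {w} [m w Iw|w Bw|w1 m w2 Bw1 Iw2].
  - exact: PartialTree (iterate_rcons Iw Tv).
  - exact: PartialBoth Bw (Iterate1 Tv).
  - by rewrite -catA; exact: PartialBoth Bw1 (iterate_rcons Iw2 Tv).
have glue m w' : iterate h e m w' -> blocks h.+2 k (w' ++ v).
  move=> Iw'; have [y [Ty _ _ _]] := T_iter ee Iw'.
  exact: blocks_glueL Ty (blocks_le (leqnSn _) Bv).
have Bv2 : blocks h.+2 k v by apply: blocks_le Bv; rewrite -addn2 leq_addr.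
case: Pw => {w} [m w Iw|w Bw|w1 m w2 Bw1 Iw2].
- by apply: PartialBlocks; exact: glue Iw.
- by apply: PartialBlocks; exact: blocks_cat.
- by apply: PartialBlocks; rewrite -catA; apply: blocks_cat Bw1 _; exact: glue Iw2.
Qed.

(** By [ideal_size_drop], the label of a pure iteration is [e] itself or has a smaller ideal, in
    which case the word is a single block. *)
Lemma partial_iterationP h k e w : mul e e = e -> sz e = k ->
  partial_iteration h k e w -> tree_or_blocks h.+3 k w e.
Proof.
move=> ee ek; case=> {w} [m w Iw|w Bw|w1 m w2 Bw1 Iw2].
- have [y [/T_mono/T_mono Ty ey ye yy]] := T_iter ee Iw.
  case: (ideal_size_drop ey ye yy) => [ye'|lt]; [by left; rewrite -ye'|right].
  by apply: Blocks1 Ty _; rewrite -ek.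
- by right; exact: blocks_le (leqnSn _) Bw.
- have [y [Ty _ _ _]] := T_iter ee Iw2.
  by right; exact: blocks_glueR Bw1 (T_mono Ty).
Qed.

(** * Runs: sequences of factors whose products all have ideal size [k] *)

Section Run.
Variables (h0 k : nat) (run : seq (seq A * M)).
Hypothesis run_T : forall i, (i < size run)%N ->
  T h0 (nth ([::], one) run i).1 (nth ([::], one) run i).2.

Local Notation pr l := (foldr (fun v x => mul v.2 x) one l).
Local Notation word l := (flatten [seq v.1 | v <- l]).

Lemma run_prod_cat (l1 l2 : seq (seq A * M)) : pr (l1 ++ l2) = mul (pr l1) (pr l2).
Proof. by elim: l1 => [|v l IH] /=; rewrite ?mul1 // IH mulA. Qed.

Lemma run_word_cat (l1 l2 : seq (seq A * M)) : word (l1 ++ l2) = word l1 ++ word l2.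
Proof. by rewrite map_cat flatten_cat. Qed.

Hypothesis run_le : forall i, (i < size run)%N -> (sz (nth ([::], one) run i).2 <= k)%N.
Hypothesis run_prod : sz (pr run) = k.

Definition segment i j : seq (seq A * M) := drop i (take j run).

Lemma segment_cat i j l : (i <= j <= l)%N -> segment i l = segment i j ++ segment j l.
Proof.
case/andP => ij jl; rewrite /segment -{1}(cat_take_drop (j - i) (drop i (take l run))).
by rewrite take_drop drop_drop subnK // take_takel.
Qed.

Lemma segment1 i : (i < size run)%N -> segment i i.+1 = [:: nth ([::], one) run i].
Proof.
move=> ir; rewrite /segment (take_nth ([::], one)) // drop_rcons ?size_takel ?(ltnW ir) //.
by rewrite drop_oversize // size_takel // ltnW.
Qed.

(* Cutting a run at the positions of one type leaves factors that all have the
   same idempotent product, by [same_type_factor]. *)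
Definition run_type i := (pr (take i run), pr (drop i run)).

Lemma take_segment i j : (i <= j)%N -> take j run = take i run ++ segment i j.
Proof. by move=> ij; rewrite -(cat_take_drop i (take j run)) take_takel. Qed.

Lemma drop_segment i j : (i <= j)%N -> drop i run = segment i j ++ drop j run.
Proof.
move=> ij; rewrite -{1}(cat_take_drop (j - i) (drop i run)).
by rewrite take_drop drop_drop subnK.
Qed.

(** The size is at most that of the first factor of the infix and at least that of the whole run. *)
Lemma infix_size (l1 l2 l3 : seq (seq A * M)) : run = l1 ++ l2 ++ l3 -> l2 <> [::] ->
  sz (pr l2) = k.
Proof.
move=> runE l2N; apply/eqP; rewrite eqn_leq; apply/andP; split; last first.
  by rewrite -run_prod runE !run_prod_cat mulA ideal_size_mul.
case: l2 l2N runE => // v l2 _ runE; apply: leq_trans (ideal_size_mulr _ _) _.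
have := @run_le (size l1); rewrite runE size_cat /= nth_cat ltnn subnn /=.
by apply; lia.
Qed.

Lemma segment_size i j : (i < j <= size run)%N -> sz (pr (segment i j)) = k.
Proof.
case/andP => ij jn; apply: (@infix_size (take i run) _ (drop j run)).
  by rewrite catA -take_segment ?cat_take_drop // ltnW.
by move/(congr1 size); rewrite size_drop size_takel //= => /eqP; rewrite subn_eq0 leqNgt ij.
Qed.

Lemma same_type_segment i j i' j' :
  (0 < i < j)%N -> (j < size run)%N -> (0 < i' < j')%N -> (j' < size run)%N ->
  run_type i = run_type j -> run_type i' = run_type j' -> run_type i = run_type i' ->
  mul (pr (segment i j)) (pr (segment i j)) = pr (segment i j)
  /\ pr (segment i j) = pr (segment i' j').
Proof.
move=> /andP[i0 ij] jn /andP[i0' ij'] jn' [tij dij] [tij' dij'] [tt dd].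
have sp : sz (pr (take i run)) = k.
  apply: (@infix_size [::] _ (drop i run)); rewrite ?cat_take_drop //.
  by move/(congr1 size); rewrite size_takel //=; lia.
have ss : sz (pr (drop i run)) = k.
  apply: (@infix_size (take i run) _ [::]); rewrite ?cats0 ?cat_take_drop //.
  by move/(congr1 size); rewrite size_drop //=; lia.
apply: (@same_type_factor (pr (take i run)) (pr (drop i run))); rewrite ?sp ?ss.
- by apply: segment_size; lia.
- by apply: segment_size; lia.
- by [].
- by rewrite -run_prod_cat -take_segment ?tij // ltnW.
- by rewrite {1}dij -run_prod_cat -drop_segment // ltnW.
- by rewrite {1}tt -run_prod_cat -take_segment 1?ltnW // -tij'.
- by rewrite {1}dd dij' -run_prod_cat -drop_segment 1?ltnW //.
Qed.

(** Induction on the number of types occurring strictly inside the segment. Cutting at all positions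
    of the type of [i.+1] leaves pieces that avoid this type inside; those between two cuts share
    one idempotent product and are iterated for three levels, and attaching the two end pieces costs
    two more: hence the factor 5. *)
Lemma run_segment (c : nat) (Th : {set M * M}) i j :
  (#|Th| <= c)%N -> (i < j <= size run)%N ->
  (forall l, (i < l < j)%N -> run_type l \in Th) ->
  tree_or_blocks (h0 + 5 * c)%N k (word (segment i j)) (pr (segment i j)).
Proof.
elim: c Th i j => [|c IH] Th i j Thc /andP[ij jn] inTh.
  have jE : j = i.+1.
    apply/eqP; rewrite eqn_leq ij andbT leqNgt; apply/negP => lt.
    have /inTh : (i < i.+1 < j)%N by lia.
    by rewrite (card0_eq (eqP _)) // -leqn0.
  rewrite jE segment1 -?jE //= cats0 mulr1 addn0; left; apply: run_T; lia.
have [jE|lt] := leqP j i.+1.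
  have -> : j = i.+1 by lia.
  rewrite segment1 /= ?cats0 ?mulr1; last by lia.
  by left; apply: (@T_le h0); [lia|apply: run_T; lia].
set i0 := i.+1; set th := run_type i0.
have thTh : th \in Th by apply: inTh; rewrite /i0; lia.
have Thc' : (#|Th :\ th| <= c)%N by move: Thc; rewrite (cardsD1 th) thTh add1n ltnS.
have IH' i' j' : (i < i' < j')%N -> (j' <= j)%N ->
    (forall l, (i' < l < j')%N -> run_type l <> th) ->
    tree_or_blocks (h0 + 5 * c)%N k (word (segment i' j')) (pr (segment i' j')).
  move=> iij jj nth; apply: (IH _ _ _ Thc'); first by lia.
  move=> l il; rewrite in_setD1 inTh ?andbT; last by lia.
  by apply/eqP/nth.
set h := (h0 + 5 * c)%N in IH'.
(* [prev] finds the last cut before [m]; the cuts are walked through backwards from [j]. *)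
have prev m : (i0 < m)%N -> exists m', [/\ (i0 <= m' < m)%N, run_type m' = th
    & forall l, (m' < l < m)%N -> run_type l <> th].
  move=> im; have ex : exists l, [&& (i0 <= l)%N, (l < m)%N & run_type l == th].
    by exists i0; rewrite leqnn im eqxx.
  have ub l : [&& (i0 <= l)%N, (l < m)%N & run_type l == th] -> (l <= m)%N.
    by case/and3P => _ /ltnW.
  case: (ex_maxnP ex ub) => m' /and3P[im' mm /eqP tm'] mx.
  exists m'; split; rewrite ?im' // => l /andP[ml lm] /eqP tl.
  by have := mx l; rewrite tl lm (leq_trans im' (ltnW ml)) => /(_ isT); rewrite leqNgt ml.
have [m [im tm lastm]] := prev j lt.
have Tlast : tree_or_blocks h k (word (segment m j)) (pr (segment m j)).
  by apply: IH' => //; rewrite /i0 in im *; lia.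
have Tfirst : tree_or_blocks h0 k (word (segment i i0)) (pr (segment i i0)).
  by rewrite segment1 /= ?cats0 ?mulr1; [left; apply: run_T; lia|lia].
have hE : (h0 + 5 * c.+1 = h.+4.+1)%N by rewrite /h; lia.
have h0h : (h0 <= h.+4)%N by rewrite /h; lia.
rewrite hE (@segment_cat i i0 j) ?run_word_cat ?run_prod_cat; last by rewrite /i0; lia.
apply: tree_or_blocks_cat; first exact: tree_or_blocks_le h0h Tfirst.
have [mE|mi0] := eqVneq m i0.
  by rewrite -mE; apply: tree_or_blocks_le Tlast; lia.
rewrite (@segment_cat i0 m j) ?run_word_cat ?run_prod_cat; last by lia.
apply: tree_or_blocks_cat; last by apply: tree_or_blocks_le Tlast; lia.
set e := pr (segment i0 m).
have lti0m : (i0 < m)%N by lia.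
have eP a b : (i0 <= a < b)%N -> (b < j)%N -> run_type a = th -> run_type b = th ->
    mul e e = e /\ e = pr (segment a b).
  move=> ab bj ta tb; apply: same_type_segment; rewrite ?ta ?tb ?tm //; rewrite /i0 in ab lti0m *; lia.
have ee : mul e e = e by case: (eP i0 m) => //; lia.
have ek : sz e = k by apply: segment_size; lia.
have chain b : (i0 < b < j)%N -> run_type b = th ->
    partial_iteration h k e (word (segment i0 b)).
  elim/ltn_ind: b => b IHb ib tb.
  have [a [ia ta nob]] := prev b ltac:(lia).
  have Tab : tree_or_blocks h k (word (segment a b)) e.
    have [_ ->] : mul e e = e /\ e = pr (segment a b) by apply: eP => //; lia.
    by apply: IH' => //; rewrite /i0 in ia; lia.
  have [aE|ai0] := eqVneq a i0; first by rewrite -aE; exact: partial_iteration1.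
  rewrite (@segment_cat i0 a b) ?run_word_cat; last by lia.
  by apply: partial_iteration_rcons => //; apply: IHb => //; lia.
by apply: partial_iterationP => //; apply: chain => //; lia.
Qed.

End Run.

Local Notation pr l := (foldr (fun v x => mul v.2 x) one l).
Local Notation word l := (flatten [seq v.1 | v <- l]).

Definition run_height := (5 * #|[set: M * M]|)%N.

Lemma run_tree h k (run : seq (seq A * M)) :
  (forall i, (i < size run)%N -> T h (nth ([::], one) run i).1 (nth ([::], one) run i).2
     /\ (sz (nth ([::], one) run i).2 <= k)%N) ->
  (0 < size run)%N -> sz (pr run) = k ->
  tree_or_blocks (h + run_height) k (word run) (pr run).
Proof.
move=> runP n0 rk.
have := @run_segment h k run (fun i lt => proj1 (runP i lt))
  (fun i lt => proj2 (runP i lt)) rk _ [set: M * M] 0%N (size run) (leqnn _).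
rewrite /segment drop0 take_size n0 leqnn => /(_ isT); apply => l _; exact: finset.in_setT.
Qed.

(** The blocks are read from the right. The invariant [state] keeps a current run of ideal size
    exactly [k] in front of a remainder already cut into smaller blocks; a factor that makes the
    product drop below [k] closes the run and forms a new block with it. *)
Lemma blocks_descend h k w : blocks h k.+1 w ->
  (exists x, T (h + run_height).+2 w x) \/ blocks (h + run_height).+2 k w.
Proof.
set h1 := (h + run_height)%N.
have hh1 : (h <= h1)%N by rewrite leq_addr.
pose ok (v : seq A * M) := T h v.1 v.2 /\ (sz v.2 <= k)%N.
suff state : blocks h k.+1 w -> exists run w2, [/\ w = word run ++ w2,
    forall i, (i < size run)%N -> ok (nth ([::], one) run i),
    run = [::] \/ sz (pr run) = k
    & w2 = [::] /\ (0 < size run)%N \/ blocks h1.+1 k w2].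
  move=> /state [run [w2 [-> okr runk Bw2]]].
  have [r0|rn0] := posnP (size run).
    by rewrite (size0nil r0) /=; case: Bw2 => [[_]|/(blocks_le (leqnSn _))]; [rewrite r0|right].
  have rk : sz (pr run) = k by case: runk rn0 => // ->.
  have Tr : tree_or_blocks h1 k (word run) (pr run) by exact: run_tree.
  case: Bw2 => [[-> _]|Bw2].
    rewrite cats0; case: Tr => [Tr|Br]; [left; exists (pr run)|right].
      by apply: T_le Tr; rewrite -addn2 leq_addr.
    by apply: blocks_le Br; rewrite -addn2 leq_addr.
  right; case: Tr => [Tr|Br]; first exact: blocks_glueL (T_mono Tr) Bw2.
  by apply: blocks_cat; [apply: blocks_le Br; rewrite -addn2 leq_addr|exact: blocks_le Bw2].
have step v x run : T h v x -> (sz x <= k)%N ->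
    (forall i, (i < size run)%N -> ok (nth ([::], one) run i)) ->
    run = [::] \/ sz (pr run) = k -> (sz (mul x (pr run)) < k)%N ->
    blocks h1.+1 k (v ++ word run).
  move=> Tv xk okr [->|rk] lt.
    by rewrite /= cats0; apply: Blocks1 (T_le _ Tv) _; [exact: leqW|rewrite /= mulr1 in lt].
  have [r0|rn0] := posnP (size run).
    rewrite (size0nil r0) /= in lt *.
    by rewrite cats0; apply: Blocks1 (T_le _ Tv) _; [exact: leqW|rewrite mulr1 in lt].
  case: (run_tree okr rn0 rk) => [Tr|Br]; last exact: blocks_glueL (T_le hh1 Tv) Br.
  exact: Blocks1 (T_prod (T_le hh1 Tv) Tr) lt.
elim=> {w} [v x Tv xk|v x w Tv xk _ [run [w2 [-> okr runk Bw2]]]].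
  have [xkE|ne] := eqVneq (sz x) k.
    exists [:: (v, x)], [::]; split; rewrite /= ?cats0 ?mulr1; [by []| |by right|by left].
    by case=> //= _; split; rewrite /= ?xkE.
  exists [::], v; split => //; [by left|right].
  by apply: Blocks1 (T_le (leqW hh1) Tv) _; rewrite ltn_neqAle ne -ltnS.
have [E|ne] := eqVneq (sz (mul x (pr run))) k.
  exists ((v, x) :: run), w2; split; rewrite /= -?catA //; [|by right|].
    by case=> [_|i /okr].
  by case: Bw2 => [[-> _]|]; [left|right].
exists [::], (v ++ (word run ++ w2)); split => //; [by left|right].
have Bv : blocks h1.+1 k (v ++ word run).
  apply: (@step v x) => //; rewrite ltn_neqAle ne /=.
  exact: leq_trans (ideal_size_mulr _ _) _.
by rewrite catA; case: Bw2 => [[-> _]|Bw2]; rewrite ?cats0 //; exact: blocks_cat.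
Qed.

Lemma tree_exists : (forall a, exists x, T 0 [:: a] x) -> forall w, w <> [::] ->
  exists x, T (run_height.+2 * #|M|.+1) w x.
Proof.
move=> Tletter w wn0.
suff claim j : (j <= #|M|.+1)%N -> (exists x, T (run_height.+2 * j) w x) \/
    blocks (run_height.+2 * j) (#|M|.+1 - j) w.
  (* After [#|M|.+1] descents the bound on the ideals is 0, so that no blocks are left. *)
  case: (claim _ (leqnn _)) => //; rewrite subnn => Bw.
  by exfalso; case: Bw.
elim: j => [_|j IH lt].
  right; rewrite muln0 subn0; elim: w wn0 => // a w IH _.
  have [x Tx] := Tletter a; have xM : (sz x < #|M|.+1)%N by rewrite ltnS ideal_size_le.
  case: w IH => [|b w] IH; first exact: Blocks1 Tx xM.
  by rewrite -[a :: _]cat1s; apply: BlocksS Tx xM _; exact: IH.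
have hE : (run_height.+2 * j.+1 = (run_height.+2 * j + run_height).+2)%N by lia.
case: (IH (ltnW lt)) => [[x Tx]|].
  by left; exists x; apply: T_le Tx; lia.
by rewrite hE -(prednK (n := #|M|.+1 - j)) ?subn_gt0 // -subnS; exact: blocks_descend.
Qed.

End Trees.

(* Simon's factorization forest theorem, except that the label of an iterated
   idempotent [e] need not be [e]: when it differs, its ideal is smaller. *)
Theorem factorization : exists H : nat, forall (A : Type) (T : nat -> seq A -> M -> Prop),
  (forall h w x, T h w x -> T h.+1 w x) ->
  (forall h w w' x x', T h w x -> T h w' x' -> T h.+1 (w ++ w') (mul x x')) ->
  (forall h e m w, mul e e = e -> iterate T h e m w ->
     exists y, [/\ T h.+1 w y, mul e y = y, mul y e = y & mul y y = y]) ->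
  (forall a, exists x, T 0%N [:: a] x) ->
  forall w, w <> [::] -> exists x, T H w x.
Proof.
exists (run_height.+2 * #|M|.+1)%N => A T mono prod iter letter w wn0.
exact: (tree_exists mono prod iter letter).
Qed.

End Factorization.

(** * Closures under product and iteration *)

Section ClosureTheory.
Variables (T : finType) (mul : T -> T -> T) (sharp : T -> T).

Lemma idempotentP (x : T) : reflect (mul x x = x) (idempotent_elt mul x).
Proof. exact: eqP. Qed.

Lemma generated_mul (X : {set T}) x y :
  x \in generated mul sharp X -> y \in generated mul sharp X ->
  mul x y \in generated mul sharp X.
Proof.
move=> xX yX; have /andP[/forall_inP sX _] := generated_stable mul sharp X.
exact: (forall_inP (sX _ xX)).
Qed.

Lemma generated_sharp (X : {set T}) x :
  x \in generated mul sharp X -> mul x x = x -> sharp x \in generated mul sharp X.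
Proof.
move=> xX /idempotentP xx; have /andP[_ /forall_inP sX] := generated_stable mul sharp X.
exact: (implyP (sX _ xX)).
Qed.

Lemma generated_in (X : {set T}) x : x \in X -> x \in generated mul sharp X.
Proof. exact/fintype.subsetP/generated_sub. Qed.

Lemma generated_ind (X : {set T}) (P : T -> Prop) :
  (forall x, x \in X -> P x) ->
  (forall x y, x \in generated mul sharp X -> y \in generated mul sharp X ->
     P x -> P y -> P (mul x y)) ->
  (forall x, x \in generated mul sharp X -> mul x x = x -> P x -> P (sharp x)) ->
  forall x, x \in generated mul sharp X -> P x.
Proof.
move=> PX Pm Ps; pose Y := [set x in generated mul sharp X | `[< P x >]].
have inY x : (x \in Y) = (x \in generated mul sharp X) && `[< P x >] by rewrite inE.
suff /fintype.subsetP sub : generated mul sharp X \subset Y.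
  by move=> x /sub; rewrite inY => /andP[_ /asboolP].
apply: generated_min.
  by apply/fintype.subsetP => x xX; rewrite inY generated_in //; apply/asboolP/PX.
apply/andP; split.
  apply/forall_inP => x; rewrite inY => /andP[xX /asboolP Px].
  apply/forall_inP => y; rewrite inY => /andP[yX /asboolP Py].
  by rewrite inY generated_mul //; apply/asboolP/Pm.
apply/forall_inP => x; rewrite inY => /andP[xX /asboolP Px].
apply/implyP => /idempotentP xx.
by rewrite inY generated_sharp //; apply/asboolP/Ps.
Qed.

Lemma set_mulP (u v : {set T}) z :
  reflect (exists x y, [/\ x \in u, y \in v & z = mul x y]) (z \in set_mul mul u v).
Proof.
apply: (iffP imset2P) => [[x y xu yv ->]|[x [y [xu yv ->]]]]; last by exists x y.
by exists x, y.
Qed.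

Lemma set_mul_in (u v : {set T}) x y : x \in u -> y \in v -> mul x y \in set_mul mul u v.
Proof. by move=> xu yv; apply/set_mulP; exists x, y. Qed.

Lemma sandwichP (u : {set T}) z :
  reflect (exists x e y, [/\ x \in u, e \in u, mul e e = e, y \in u
     & z = mul (mul x (sharp e)) y]) (z \in sandwich mul sharp u).
Proof.
apply: (iffP (set_mulP _ _ _)) => [[w [y [/set_mulP[x [f [xu + ->]] yu ->]]]]|].
  by case/imsetP => e; rewrite inE => /andP[eu /idempotentP ee] ->; exists x, e, y.
case=> x [e [y [xu eu ee yu ->]]]; exists (mul x (sharp e)), y; split => //.
apply: set_mul_in => //; apply/imsetP; exists e => //.
by rewrite inE eu; apply/idempotentP.
Qed.

Lemma saturate_generated (X : {set T}) : saturate mul sharp X = generated mul sharp X.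
Proof.
pose F := close_step mul sharp.
have FS (Y : {set T}) : Y \subset F Y.
  by rewrite /F /close_step -finset.setUA finset.subsetUl.
have subX n : X \subset iter n F X.
  by elim: n => //= n IH; exact: fintype.subset_trans IH (FS _).
have le_gen n : iter n F X \subset generated mul sharp X.
  elim: n => [|n /= /fintype.subsetP IH]; first exact: generated_sub.
  apply/fintype.subsetP => z; rewrite /F /close_step !inE -orbA => /or3P[/IH//|/set_mulP|/imsetP].
    by case=> x [y [/IH xI /IH yI ->]]; exact: generated_mul.
  by case=> x; rewrite inE => /andP[/IH xI /idempotentP xx] ->; exact: generated_sharp.
have grow n : F (iter n F X) = iter n F X \/ (n < #|iter n.+1 F X|)%N.
  elim: n => [|n [IH|IH]].
  - have [e|ne] := eqVneq (F X) X; [by left|right; rewrite /= card_gt0].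
    by apply: contra_neq ne => e0; move: (FS X); rewrite e0 finset.subset0 => /eqP ->.
  - by left => /=; rewrite !IH.
  have [e|ne] := eqVneq (F (iter n.+1 F X)) (iter n.+1 F X); [by left|right].
  apply: leq_ltn_trans IH _; apply: proper_card.
  by rewrite finset.properEneq FS andbT eq_sym.
apply/eqP; rewrite finset.eqEsubset le_gen /=; apply: generated_min; first exact: subX.
have fixF : F (saturate mul sharp X) = saturate mul sharp X.
  by case: (grow #|T|) => // /leq_trans/(_ (max_card _)); rewrite ltnn.
apply/andP; split.
  apply/forall_inP => x xX; apply/forall_inP => y yX.
  by rewrite -fixF !inE set_mul_in ?orbT.
apply/forall_inP => x xX; apply/implyP => xx.
rewrite -fixF !inE; apply/orP; right; apply/imsetP; exists x => //.
by rewrite inE xX.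
Qed.

Lemma saturate_sharpE : saturate_sharp mul sharp = set_sharp mul sharp.
Proof. by apply/funext => u; exact: saturate_generated. Qed.

Hypothesis mulA : associative mul.

Lemma set_mulA : associative (set_mul mul).
Proof.
move=> u v w; apply/setP => z; apply/set_mulP/set_mulP.
  case=> x [_ [xu /set_mulP[y [t [yv tw ->]] ->]]].
  by exists (mul x y), t; rewrite mulA; split => //; exact: set_mul_in.
case=> _ [t [/set_mulP[x [y [xu yv ->]] tw ->]]].
by exists x, (mul y t); rewrite mulA; split => //; exact: set_mul_in.
Qed.

Lemma set_mul1 (one : T) : left_id one mul -> left_id [set one] (set_mul mul).
Proof.
move=> mul1 u; apply/setP => z; apply/set_mulP/idP.
  by case=> x [y [/set1P -> yu ->]]; rewrite mul1.
by move=> zu; exists one, z; rewrite mul1 finset.in_set1 eqxx.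
Qed.

Lemma set_mulr1 (one : T) : right_id one mul -> right_id [set one] (set_mul mul).
Proof.
move=> mulr1 u; apply/setP => z; apply/set_mulP/idP.
  by case=> x [y [xu /set1P -> ->]]; rewrite mulr1.
by move=> zu; exists z, one; rewrite mulr1 finset.in_set1 eqxx.
Qed.

(** Exponents start at 1, so that no unit is involved: [power x n] is the power with exponent
    [n.+1]. *)
Fixpoint power (x : T) n := if n is n'.+1 then mul x (power x n') else x.

Lemma powerD x m n : mul (power x m) (power x n) = power x (m + n).+1.
Proof. by elim: m => //= m IH; rewrite -mulA IH. Qed.

Lemma idempotent_power (x : T) : exists n, mul (power x n) (power x n) = power x n.
Proof.
have [i [j [lt e]]] : exists i j, (i < j)%N /\ power x i = power x j.
  have /injectivePn[i [j ij e]] : ~~ injectiveb (fun i : 'I_#|T|.+1 => power x i).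
    by apply/negP => /injectiveP/leq_card; rewrite card_ord ltnn.
  case: (ltngtP i j) => [lt|lt|/val_inj E]; last by rewrite E eqxx in ij.
    by exists i, j.
  by exists j, i.
have shift k n : (i <= n)%N -> power x n = power x (n + k * (j - i)).
  move=> le; elim: k => [|k IH]; first by rewrite addn0.
  rewrite IH mulSn; set z := (k * (j - i))%N.
  have [E|ne] := eqVneq (n + z)%N i; first by rewrite addnCA E e; congr power; lia.
  have -> : (n + z = ((n + z).-1 - i + i).+1)%N by lia.
  have -> : (n + (j - i + z) = ((n + z).-1 - i + j).+1)%N by lia.
  by rewrite -!powerD e.
(* The exponent is [i.+1 * (j - i)]: a multiple of the period [j - i], and at least [i.+1], from
   where the powers are periodic. *)
exists (i.+1 * (j - i)).-1; rewrite powerD [in RHS](@shift i.+1); first by congr power; nia.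
by nia.
Qed.

End ClosureTheory.

(** * The iteration of an idempotent set, for matrices and for pairs alike *)

Section IterationTheory.
Variables (T : finType) (mul : T -> T -> T) (sharp : T -> T) (tot : pred T).
Hypothesis mulA : associative mul.
Hypothesis tot_mul : forall x y, tot x -> tot y -> tot (mul x y).
Hypothesis tot_sharp : forall e, tot e -> mul e e = e -> tot (sharp e).
Hypothesis sharpL : forall e, tot e -> mul e e = e -> mul e (sharp e) = sharp e.
Hypothesis sharpR : forall e, tot e -> mul e e = e -> mul (sharp e) e = sharp e.
Hypothesis sharp_idem : forall e, tot e -> mul e e = e -> mul (sharp e) (sharp e) = sharp e.

Variable u : {set T}.
Hypothesis u_tot : forall x, x \in u -> tot x.
Hypothesis u_idem : set_mul mul u u = u.

Local Notation v := (set_sharp mul sharp u).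

Lemma idem_mul_in x y : x \in u -> y \in u -> mul x y \in u.
Proof. by move=> xu yu; rewrite -u_idem set_mul_in. Qed.

Lemma idem_split x : x \in u -> exists y z, [/\ y \in u, z \in u & x = mul y z].
Proof. by rewrite -{1}u_idem => /set_mulP. Qed.

Lemma set_sharp_ind (P : T -> Prop) :
  (forall x e y, x \in u -> e \in u -> mul e e = e -> y \in u ->
     P (mul (mul x (sharp e)) y)) ->
  (forall x y, x \in v -> y \in v -> P x -> P y -> P (mul x y)) ->
  (forall x, x \in v -> mul x x = x -> P x -> P (sharp x)) ->
  forall x, x \in v -> P x.
Proof.
move=> Pu Pm Ps; apply: generated_ind => // _ /sandwichP[x [e [y [xu eu ee yu ->]]]].
exact: Pu.
Qed.

Lemma set_sharp_tot x : x \in v -> tot x.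
Proof.
move: x; apply: set_sharp_ind => [y e z yu eu ee zu|x y _ _|x _ xx tx].
- apply: tot_mul (u_tot zu); apply: (tot_mul (u_tot yu)); exact: tot_sharp (u_tot eu) ee.
- exact: tot_mul.
- exact: tot_sharp.
Qed.

Lemma sandwich_in x e y : x \in u -> e \in u -> mul e e = e -> y \in u ->
  mul (mul x (sharp e)) y \in v.
Proof. by move=> xu eu ee yu; apply: generated_in; apply/sandwichP; exists x, e, y. Qed.

(** The two absorption laws give [e^# = e e^# e], a sandwich with outer factors in [u]. *)
Lemma sharp_in e : e \in u -> mul e e = e -> sharp e \in v.
Proof.
move=> eu ee; rewrite -(sharpL (u_tot eu) ee) -(sharpR (u_tot eu) ee) mulA.
exact: sandwich_in.
Qed.

Lemma set_sharp_mull x y : x \in u -> y \in v -> mul x y \in v.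
Proof.
move=> xu; move: y; apply: set_sharp_ind => [y e z yu eu ee zu|y z _ zv yv _|y yv yy xyv].
- by rewrite !mulA sandwich_in ?idem_mul_in.
- by rewrite mulA; exact: generated_mul.
- have ty := set_sharp_tot yv.
  by rewrite -(sharpL ty yy) mulA; apply: generated_mul => //; exact: generated_sharp.
Qed.

Lemma set_sharp_mulr x y : x \in v -> y \in u -> mul x y \in v.
Proof.
move=> + yu; move: x; apply: set_sharp_ind => [x e z xu eu ee zu|x z xv _ _ zv|x xv xx xyv].
- by rewrite -!mulA mulA sandwich_in ?idem_mul_in.
- by rewrite -mulA; exact: generated_mul.
- have tx := set_sharp_tot xv.
  by rewrite -(sharpR tx xx) -mulA; apply: generated_mul => //; exact: generated_sharp.
Qed.

(** With its mirror image and [set_sharp_idem], this is what the factorization theorem requires of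
    the label of an iterated idempotent. A factor from [u] splits off a sandwich because [u] is
    idempotent, and off [sharp z] because [sharp z = mul z (sharp z)]. *)
Lemma mul_set_sharp : set_mul mul u v = v.
Proof.
apply/setP => z; apply/set_mulP/idP => [[x [y [xu yv ->]]]|]; first exact: set_sharp_mull.
move: z; apply: set_sharp_ind => [_ e y /idem_split[x1 [x2 [x1u x2u ->]]] eu ee yu|z z' _ zv' [x [y [xu yv ->]]] _|z zv zz [x [y [xu yv zE]]]].
- by exists x1, (mul (mul x2 (sharp e)) y); rewrite !mulA sandwich_in.
- by exists x, (mul y z'); rewrite mulA; split => //; exact: generated_mul.
- exists x, (mul y (sharp z)); rewrite mulA -zE (sharpL (set_sharp_tot zv) zz).
  by split => //; apply: generated_mul => //; exact: generated_sharp.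
Qed.

Lemma set_sharp_mul : set_mul mul v u = v.
Proof.
apply/setP => z; apply/set_mulP/idP => [[x [y [xv yu ->]]]|]; first exact: set_sharp_mulr.
move: z; apply: set_sharp_ind => [x e _ xu eu ee /idem_split[y1 [y2 [y1u y2u ->]]]|z' z zv' _ _ [x [y [xv yu ->]]]|z zv zz [x [y [xv yu zE]]]].
- by exists (mul (mul x (sharp e)) y1), y2; rewrite !mulA sandwich_in.
- by exists (mul z' x), y; rewrite mulA; split => //; exact: generated_mul.
- exists (mul (sharp z) x), y; rewrite -mulA -zE (sharpR (set_sharp_tot zv) zz).
  by split => //; apply: generated_mul => //; exact: generated_sharp.
Qed.

Lemma set_sharp_idem : set_mul mul v v = v.
Proof.
apply/setP => z; apply/set_mulP/idP => [[x [y [xv yv ->]]]|]; first exact: generated_mul.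
move: z; apply: set_sharp_ind => [x e y xu eu ee yu|z z' _ zv' [x [y [xv yv ->]]] _|z zv zz _].
(* [x e^# y = (x e^# e) (e e^# y)] is a product of two sandwiches. *)
- exists (mul (mul x (sharp e)) e), (mul (mul e (sharp e)) y).
  rewrite !sandwich_in //; split => //.
  have te := u_tot eu.
  by rewrite (sharpL te ee) mulA -(mulA _ e) (sharpL te ee) -[in RHS](mulA x) (sharp_idem te ee).
- by exists x, (mul y z'); rewrite mulA; split => //; exact: generated_mul.
- by exists (sharp z), (sharp z); rewrite (sharp_idem (set_sharp_tot zv) zz); split => //; exact: generated_sharp.
Qed.

End IterationTheory.


(** * Binary matrices *)

Section BinaryMatrixTheory.
Variable S : finType.
Implicit Types (U V W D E : bmx S) (s t : S).

Lemma bmx_mulP U V s t :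
  reflect (exists s', U (s, s') /\ V (s', t)) (bmx_mul U V (s, t)).
Proof.
rewrite ffunE /=; apply: (iffP existsP) => -[s'].
  by case/andP => *; exists s'.
by case=> *; exists s'; apply/andP.
Qed.

Lemma bmx_ext U V : (forall s t, U (s, t) <-> V (s, t)) -> U = V.
Proof. by move=> e; apply/ffunP => -[s t]; apply/idP/idP => /e. Qed.

Lemma bmx_mulA : associative (@bmx_mul S).
Proof.
move=> U V W; apply: bmx_ext => s t; split=> /bmx_mulP[x].
  case=> Ux /bmx_mulP[y [Vy Wy]]; apply/bmx_mulP; exists y; split => //.
  by apply/bmx_mulP; exists x.
case=> /bmx_mulP[y [Uy Vy]] Wx; apply/bmx_mulP; exists y; split => //.
by apply/bmx_mulP; exists x.
Qed.

Lemma bmx_mul1 : left_id (bmx_one S) (@bmx_mul S).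
Proof.
move=> U; apply: bmx_ext => s t; split => [/bmx_mulP[x]|Ut].
  by rewrite ffunE /= => -[/eqP ->].
by apply/bmx_mulP; exists s; rewrite ffunE /= eqxx.
Qed.

Lemma bmx_mulr1 : right_id (bmx_one S) (@bmx_mul S).
Proof.
move=> U; apply: bmx_ext => s t; split => [/bmx_mulP[x]|Ut].
  by rewrite ffunE /= => -[Ux /eqP <-].
by apply/bmx_mulP; exists t; rewrite ffunE /= eqxx.
Qed.

Lemma bmx_idem_trans E r s t : bmx_mul E E = E -> E (r, s) -> E (s, t) -> E (r, t).
Proof. by move=> EE rs st; rewrite -EE; apply/bmx_mulP; exists s. Qed.

Lemma recurrentP U t : reflect (forall t', U (t, t') -> U (t', t)) (recurrent U t).
Proof. by apply: (iffP forallP) => H t'; apply/implyP; apply: H. Qed.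

Lemma bmx_sharpE U s t : bmx_sharp U (s, t) = U (s, t) && recurrent U t.
Proof. by rewrite ffunE. Qed.

Lemma recurrent_step E s t : bmx_mul E E = E -> recurrent E s -> E (s, t) -> recurrent E t.
Proof.
move=> EE /recurrentP rs st; apply/recurrentP => t' tt'.
by apply: (bmx_idem_trans EE _ st); apply: rs; exact: bmx_idem_trans EE st tt'.
Qed.

(** A state without successors would be vacuously recurrent and could be lost in [E^# E]; the
    matrices of a Markov monoid are all total. *)
Definition bmx_total U := [forall s, exists t, U (s, t)].

Lemma totalP U : reflect (forall s, exists t, U (s, t)) (bmx_total U).
Proof. by apply: (iffP forallP) => H s; apply/existsP; apply: H. Qed.

Lemma total_one : bmx_total (bmx_one S).
Proof. by apply/totalP => s; exists s; rewrite ffunE /=. Qed.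

Lemma total_mul U V : bmx_total U -> bmx_total V -> bmx_total (bmx_mul U V).
Proof.
move=> /totalP tU /totalP tV; apply/totalP => s.
by have [x sx] := tU s; have [t xt] := tV x; exists t; apply/bmx_mulP; exists x.
Qed.

Lemma reach_recurrent E s : bmx_mul E E = E -> bmx_total E ->
  exists t, E (s, t) /\ recurrent E t.
Proof.
move=> EE /totalP tE; have [r0 sr0] := tE s.
have [r sr minr] := @arg_minnP _ r0 (fun r => E (s, r)) (fun r => #|[set t | E (r, t)]|) sr0.
have same x : E (r, x) -> [set t | E (x, t)] = [set t | E (r, t)].
  move=> rx; apply/eqP; rewrite eqEcard minr ?andbT; last exact: bmx_idem_trans EE sr rx.
  by apply/fintype.subsetP => t; rewrite !inE; exact: bmx_idem_trans.
(* [r] has the fewest successors among the successors of [s]. It may be transient, but any successor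
   [x] of it is recurrent: whatever [x] reaches has the same successors as [r], among them [x]. *)
have [x rx] := tE r; exists x; split; first exact: bmx_idem_trans EE sr rx.
apply/recurrentP => t xt; have rt := bmx_idem_trans EE rx xt.
by have /setP/(_ x) := same t rt; rewrite !inE rx.
Qed.

Lemma recurrent_refl E t : bmx_mul E E = E -> bmx_total E -> recurrent E t -> E (t, t).
Proof.
move=> EE /totalP tE /recurrentP rt; have [x tx] := tE t.
exact: bmx_idem_trans EE tx (rt _ tx).
Qed.

Lemma total_sharp E : bmx_total E -> bmx_mul E E = E -> bmx_total (bmx_sharp E).
Proof.
move=> tE EE; apply/totalP => s; have [t [st rt]] := reach_recurrent s EE tE.
by exists t; rewrite bmx_sharpE st.
Qed.

Lemma bmx_sharpL E : bmx_mul E E = E -> bmx_mul E (bmx_sharp E) = bmx_sharp E.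
Proof.
move=> EE; apply: bmx_ext => s t; rewrite bmx_sharpE; split.
  case/bmx_mulP => x [sx]; rewrite bmx_sharpE => /andP[xt ->].
  by rewrite andbT; exact: bmx_idem_trans EE sx xt.
case/andP; rewrite -{1}EE => /bmx_mulP[x [sx xt]] rt.
by apply/bmx_mulP; exists x; rewrite bmx_sharpE xt.
Qed.

Lemma bmx_sharpR E : bmx_total E -> bmx_mul E E = E -> bmx_mul (bmx_sharp E) E = bmx_sharp E.
Proof.
move=> tE EE; apply: bmx_ext => s t; rewrite bmx_sharpE; split.
  case/bmx_mulP => x []; rewrite bmx_sharpE => /andP[sx rx] xt.
  by rewrite (bmx_idem_trans EE sx xt) (recurrent_step EE rx xt).
case/andP => st rt; apply/bmx_mulP; exists t; rewrite bmx_sharpE st rt.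
by rewrite recurrent_refl.
Qed.

Lemma bmx_sharp_idem E : bmx_total E -> bmx_mul E E = E ->
  bmx_mul (bmx_sharp E) (bmx_sharp E) = bmx_sharp E.
Proof.
move=> tE EE; apply: bmx_ext => s t; rewrite bmx_sharpE; split.
  case/bmx_mulP => x []; rewrite !bmx_sharpE => /andP[sx _] /andP[xt ->].
  by rewrite (bmx_idem_trans EE sx xt).
case/andP => st rt; apply/bmx_mulP; exists t; rewrite !bmx_sharpE st rt.
by rewrite recurrent_refl.
Qed.

Lemma bmx2_mulA : associative (@bmx2_mul S).
Proof. by move=> x y z; rewrite /bmx2_mul /= !bmx_mulA. Qed.

Lemma bmx2_mul1 : left_id (bmx_one S, bmx_one S) (@bmx2_mul S).
Proof. by move=> [x y]; rewrite /bmx2_mul /= !bmx_mul1. Qed.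

Lemma bmx2_mulr1 : right_id (bmx_one S, bmx_one S) (@bmx2_mul S).
Proof. by move=> [x y]; rewrite /bmx2_mul /= !bmx_mulr1. Qed.

Lemma bmx2_idemP (x : bmx2 S) :
  bmx2_mul x x = x <-> bmx_mul x.1 x.1 = x.1 /\ bmx_mul x.2 x.2 = x.2.
Proof. by case: x => U V; split=> [[-> ->]|[/= e1 e2]]; rewrite // /bmx2_mul /= e1 e2. Qed.

Definition total2 (x : bmx2 S) := bmx_total x.1.

Lemma total2_mul (x y : bmx2 S) : total2 x -> total2 y -> total2 (bmx2_mul x y).
Proof. exact: total_mul. Qed.

Lemma total2_sharp (e : bmx2 S) : total2 e -> bmx2_mul e e = e -> total2 (bmx2_sharp e).
Proof. by move=> te /bmx2_idemP[e1 _]; exact: total_sharp. Qed.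

Lemma bmx2_sharpL (e : bmx2 S) : total2 e -> bmx2_mul e e = e ->
  bmx2_mul e (bmx2_sharp e) = bmx2_sharp e.
Proof. by move=> te /bmx2_idemP[e1 e2]; rewrite /bmx2_mul /bmx2_sharp /= bmx_sharpL // e2. Qed.

Lemma bmx2_sharpR (e : bmx2 S) : total2 e -> bmx2_mul e e = e ->
  bmx2_mul (bmx2_sharp e) e = bmx2_sharp e.
Proof. by move=> te /bmx2_idemP[e1 e2]; rewrite /bmx2_mul /bmx2_sharp /= bmx_sharpR // e2. Qed.

Lemma bmx2_sharp_idem (e : bmx2 S) : total2 e -> bmx2_mul e e = e ->
  bmx2_mul (bmx2_sharp e) (bmx2_sharp e) = bmx2_sharp e.
Proof. by move=> te /bmx2_idemP[e1 e2]; rewrite /bmx2_mul /bmx2_sharp /= bmx_sharp_idem // e2. Qed.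

Definition refines U V := [forall st, U st ==> V st].

Lemma refinesP U V : reflect (forall s t, U (s, t) -> V (s, t)) (refines U V).
Proof.
apply: (iffP forallP) => H; first by move=> s t; apply/implyP.
by case=> s t; apply/implyP/H.
Qed.

Lemma refines_mul U V U' V' : refines U U' -> refines V V' ->
  refines (bmx_mul U V) (bmx_mul U' V').
Proof.
move=> /refinesP HU /refinesP HV; apply/refinesP => s t /bmx_mulP[x [sx xt]].
by apply/bmx_mulP; exists x; split; [exact: HU|exact: HV].
Qed.

Lemma refines_trans U V W : refines U V -> refines V W -> refines U W.
Proof. by move=> /refinesP a /refinesP b; apply/refinesP => s t /a/b. Qed.

Lemma refines_refl U : refines U U.
Proof. exact/refinesP. Qed.

Lemma refines_sharp U : refines (bmx_sharp U) U.
Proof. by apply/refinesP => s t; rewrite bmx_sharpE => /andP[]. Qed.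

(* For idempotent pairs this is what the absence of leaks amounts to. *)
Definition tight E W := forall t t' : S, recurrent E t -> W (t, t') -> E (t', t).

(** From [t'] some [E]-recurrent [r] is reached, and [W (t, r)] by idempotence. Without a leak
    [E (t, r)] holds, and recurrence of [t] leads back from [r] to [t]. *)
Lemma tight_of_no_leak E W :
  bmx_mul E E = E -> bmx_mul W W = W -> bmx_total E -> refines E W ->
  ~~ leak (E, W) -> tight E W.
Proof.
move=> EE WW tE /refinesP EW nl t t' rt tt'.
have [r [t'r rr]] := reach_recurrent t' EE tE.
have tr : E (t, r).
  apply: contraNT nl => ntr; rewrite /leak; apply/andP; split.
    by apply/idempotentP/bmx2_idemP.
  apply/existsP; exists t; apply/existsP; exists r; rewrite /= rt rr ntr /=.
  exact: bmx_idem_trans WW tt' (EW _ _ t'r).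
by apply: (bmx_idem_trans EE t'r); move/recurrentP: rt; apply.
Qed.

Lemma tight_recurrent D E W :
  bmx_mul D D = D -> bmx_mul E E = E -> bmx_total D -> refines D E -> refines E W ->
  tight D W -> forall t, recurrent D t -> recurrent E t.
Proof.
move=> DD EE tD /refinesP DE /refinesP EW tDW t rt; apply/recurrentP => t' tt'.
by apply: DE; apply: tDW => //; exact: EW.
Qed.

(** From [r] follow [D] to a [D]-recurrent [r1]; [E] leads from [r1] back to [r] and [W] on to [t].
    Tightness of [D] then leads from [t] to [r1], and [E] from there to [r]. *)
Lemma tight_sup D E W :
  bmx_mul D D = D -> bmx_mul E E = E -> bmx_mul W W = W ->
  bmx_total D -> refines D E -> refines E W -> tight D W -> tight E W.
Proof.
move=> DD EE WW tD DE EW tDW r t rr rt.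
have [r1 [rr1 r1D]] := reach_recurrent r DD tD.
move/refinesP: (DE) => DE'; move/refinesP: (EW) => EW'; move/recurrentP: rr => rr.
have Er1 : E (r1, r) by apply: rr; exact: DE'.
apply: (bmx_idem_trans EE _ Er1); apply: DE'; apply: tDW => //.
exact: bmx_idem_trans WW (EW' _ _ Er1) rt.
Qed.

End BinaryMatrixTheory.

(** * Products of stochastic kernels *)

Section Kernels.
Variables (R : realType) (S : finType).

Definition kernel := S -> S -> R.

Definition kmul (P Q : kernel) : kernel := fun s t => \sum_x P s x * Q x t.

Definition kone : kernel := fun s t => (s == t)%:R.

Definition stochastic (P : kernel) :=
  (forall s t, 0 <= P s t) /\ (forall s, \sum_t P s t = 1).

Lemma kmulA : associative kmul.
Proof.
move=> P Q U; apply/funext => s; apply/funext => t; rewrite /kmul.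
under eq_bigr do rewrite mulr_sumr.
rewrite exchange_big /=; apply: eq_bigr => y _; rewrite mulr_suml.
by apply: eq_bigr => x _; rewrite mulrA.
Qed.

Lemma kmul1 : left_id kone kmul.
Proof.
move=> P; apply/funext => s; apply/funext => t.
rewrite /kmul (bigD1 s) //= /kone eqxx mul1r big1 ?addr0 // => x /negPf.
by rewrite eq_sym => ->; rewrite mul0r.
Qed.

Lemma kmulr1 : right_id kone kmul.
Proof.
move=> P; apply/funext => s; apply/funext => t.
rewrite /kmul (bigD1 t) //= /kone eqxx mulr1 big1 ?addr0 // => x /negPf ->.
by rewrite mulr0.
Qed.

Lemma stochastic_mul P Q : stochastic P -> stochastic Q -> stochastic (kmul P Q).
Proof.
move=> [P0 P1] [Q0 Q1]; split=> s; first by move=> t; apply: sumr_ge0 => x _; exact: mulr_ge0.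
rewrite /kmul exchange_big /=; under eq_bigr do rewrite -mulr_sumr Q1 mulr1.
exact: P1.
Qed.

Lemma stochastic_one : stochastic kone.
Proof.
split=> s; first by move=> t; exact: ler0n.
by rewrite (bigD1 s) //= /kone eqxx big1 ?addr0 // => x; rewrite eq_sym => /negPf ->.
Qed.

Lemma stochastic_le1 P s t : stochastic P -> P s t <= 1.
Proof.
by move=> [P0 P1]; rewrite -(P1 s) (bigD1 t) //= lerDl sumr_ge0.
Qed.

Lemma stochastic_avg_le P s (f : S -> R) b : stochastic P ->
  (forall x, f x <= b) -> \sum_x P s x * f x <= b.
Proof.
move=> [P0 P1] fb; rewrite -[b]mul1r -(P1 s) mulr_suml.
by apply: ler_sum => x _; exact: ler_wpM2l.
Qed.

Definition supported (W : bmx S) (P : kernel) := forall s t, ~~ W (s, t) -> P s t = 0.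

Definition bounded_below d (E : bmx S) (P : kernel) := forall s t, E (s, t) -> d <= P s t.

Definition bounded_above eps (E : bmx S) (P : kernel) :=
  forall s t, ~~ E (s, t) -> P s t <= eps.

Lemma supported_mul W W' P P' : supported W P -> supported W' P' ->
  supported (bmx_mul W W') (kmul P P').
Proof.
move=> sP sP' s t nW; apply: big1 => x _.
have [Wx|/sP->] := boolP (W (s, x)); last by rewrite mul0r.
have [Wx'|/sP'->] := boolP (W' (x, t)); last by rewrite mulr0.
by case/negP: nW; apply/bmx_mulP; exists x.
Qed.

Lemma bounded_below_mul d d' E E' P P' : stochastic P -> stochastic P' ->
  0 <= d -> 0 <= d' ->
  bounded_below d E P -> bounded_below d' E' P' ->
  bounded_below (d * d') (bmx_mul E E') (kmul P P').
Proof.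
move=> [P0 _] [P0' _] d0 d0' bP bP' s t /bmx_mulP[x [sx xt]].
rewrite /kmul (bigD1 x) //= -[leLHS]addr0; apply: lerD.
  by apply: ler_pM => //; [exact: bP|exact: bP'].
by apply: sumr_ge0 => y _; exact: mulr_ge0.
Qed.

Lemma bounded_below_le d d' E P : d' <= d -> bounded_below d E P -> bounded_below d' E P.
Proof. by move=> dd bP s t /bP; exact: le_trans. Qed.

Lemma bounded_below_refines d E E' P : refines E' E -> bounded_below d E P ->
  bounded_below d E' P.
Proof. by move=> /refinesP EE bP s t /EE/bP. Qed.

(** Intermediate states outside [E] contribute at most [eps] each; over the others [eps'] is only
    averaged. Its coefficient 1 keeps the error of a power linear in the number of factors. *)
Lemma bounded_above_mul eps eps' E E' P P' : stochastic P -> stochastic P' ->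
  0 <= eps -> 0 <= eps' ->
  bounded_above eps E P -> bounded_above eps' E' P' ->
  bounded_above (#|S|%:R * eps + eps') (bmx_mul E E') (kmul P P').
Proof.
move=> sP sP' e0 e0' bP bP' s t nE.
have [P0 _] := sP; have [P0' _] := sP'.
apply: (@le_trans _ _ (\sum_x (eps + P s x * eps'))).
  apply: ler_sum => x _; have [sx|nsx] := boolP (E (s, x)).
    rewrite -[leLHS]add0r lerD // ler_wpM2l //; apply: bP'.
    by apply: contra nE => xt; apply/bmx_mulP; exists x.
  rewrite -[leLHS]addr0 lerD ?mulr_ge0 //.
  by rewrite -[eps]mulr1 ler_pM ?bP ?stochastic_le1.
rewrite big_split /= sumr_const mulr_natl lerD2l.
exact: stochastic_avg_le.
Qed.

Lemma bounded_above_le eps eps' E P : eps <= eps' -> bounded_above eps E P ->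
  bounded_above eps' E P.
Proof. by move=> ee bP s t /bP/le_trans; apply. Qed.

Inductive kernel_power (C : kernel -> Prop) : nat -> kernel -> Prop :=
| KernelPower1 P : C P -> kernel_power C 1 P
| KernelPowerS P m Q : C P -> kernel_power C m Q -> kernel_power C m.+1 (kmul P Q).

Lemma kernel_power_sub (C C' : kernel -> Prop) m P : (forall P, C P -> C' P) ->
  kernel_power C m P -> kernel_power C' m P.
Proof.
move=> CC; elim=> {m P} [P /CC|P m Q /CC CP _ IH]; first exact: KernelPower1.
exact: KernelPowerS.
Qed.

Lemma power_stochastic (C : kernel -> Prop) m P : (forall P, C P -> stochastic P) ->
  kernel_power C m P -> stochastic P.
Proof. by move=> CP; elim=> {m P} [P /CP//|P m Q /CP + _]; exact: stochastic_mul. Qed.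

Lemma power_supported W m P : bmx_mul W W = W ->
  kernel_power (supported W) m P -> supported W P.
Proof.
move=> WW; elim=> {m P} [//|P m Q sP _ sQ].
by rewrite -WW; exact: supported_mul.
Qed.

Lemma power_bounded_above eps E m P : bmx_mul E E = E -> 0 <= eps ->
  kernel_power (fun P => stochastic P /\ bounded_above eps E P) m P ->
  bounded_above (m%:R * (#|S|.+1%:R * eps)) E P.
Proof.
move=> EE e0; elim=> {m P} [P [_ bP]|P m Q [sP bP] pQ bQ].
  by apply: bounded_above_le bP; rewrite mul1r ler_peMl // ler1n.
have sQ : stochastic Q by apply: power_stochastic pQ => ? [].
have b0 : 0 <= m%:R * (#|S|.+1%:R * eps) by rewrite !mulr_ge0.
have := bounded_above_mul sP sQ e0 b0 bP bQ; rewrite EE; apply: bounded_above_le.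
rewrite -[m.+1]add1n natrD mulrDl mul1r lerD2r.
by rewrite ler_wpM2r // ler_nat.
Qed.

(** * Lower bounds on [E^#] for products of many kernels *)

Section LowerBound.
Variables (E W : bmx S) (d : R).
Hypotheses (EE : bmx_mul E E = E) (WW : bmx_mul W W = W) (tE : bmx_total E).
Hypotheses (EW : refines E W) (tightEW : tight E W) (d01 : 0 <= d <= 1).

Let controlled P := [/\ stochastic P, supported W P & bounded_below d E P].

(** All states met on the way are [W]-reachable from [t], so by tightness the last factor returns to
    [t] with probability at least [d]. *)
Lemma power_recurrent m P t : kernel_power controlled m P -> recurrent E t ->
  forall x, W (t, x) -> d <= P x t.
Proof.
move=> + rt; elim=> {m P} [P [_ _ bP]|P m Q [[P0 P1] sP bP] _ IH] x tx.
  by apply: bP; exact: tightEW.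
rewrite -[d]mul1r -(P1 x) mulr_suml; apply: ler_sum => y _.
have [xy|/sP->] := boolP (W (x, y)); last by rewrite !mul0r.
by apply: ler_wpM2l => //; apply: IH; exact: bmx_idem_trans WW tx xy.
Qed.

(* Leaktightness makes the bound independent of the number [m] of factors. *)
Lemma power_sharp_below m P : kernel_power controlled m P ->
  bounded_below (d ^+ 2) (bmx_sharp E) P.
Proof.
case/andP: d01 => d0 d1 CP s t; rewrite bmx_sharpE => /andP[st rt].
have Wtt : W (t, t) by move/refinesP: EW; apply; exact: recurrent_refl.
case: CP => {m P} [P [_ _ bP]|P m Q [[P0 _] _ bP] CQ].
  apply: le_trans (bP _ _ st); rewrite expr2 -[leRHS]mulr1; exact: ler_wpM2l.
have [Q0 _] : stochastic Q by apply: power_stochastic CQ => ? [].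
rewrite /kmul (bigD1 t) //= expr2 -[leLHS]addr0; apply: lerD.
  by apply: ler_pM => //; [exact: bP|exact: power_recurrent CQ rt _ Wtt].
by apply: sumr_ge0 => y _; exact: mulr_ge0.
Qed.

End LowerBound.

(** * Upper bounds outside [E^#] for products of many kernels *)

Section UpperBound.
Variables (D E W : bmx S) (d eps g : R).
Hypotheses (DD : bmx_mul D D = D) (EE : bmx_mul E E = E) (WW : bmx_mul W W = W).
Hypotheses (tD : bmx_total D) (DE : refines D E) (EW : refines E W) (tightDW : tight D W).
Hypotheses (d0 : 0 < d) (d1 : d <= 1) (eps0 : 0 <= eps) (gE : g * d = #|S|%:R * eps).

Let controlled P :=
  [/\ stochastic P, supported W P, bounded_below d D P & bounded_above eps E P].

Let mass (P : kernel) s := \sum_(t | ~~ recurrent E t) P s t.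

Let d1' : 0 <= 1 - d.
Proof. by rewrite subr_ge0. Qed.

Let g0 : 0 <= g.
Proof. by rewrite -(pmulr_lge0 _ d0) gE mulr_ge0. Qed.

Let massE P s : mass P s = \sum_t P s t * (~~ recurrent E t)%:R.
Proof.
rewrite /mass big_mkcond; apply: eq_bigr => t _.
by case: ifP; rewrite ?mulr1 ?mulr0.
Qed.

(** [D] leads from every state to a [D]-recurrent one, which by tightness is also [E]-recurrent. *)
Lemma transient_escape P s : controlled P -> mass P s <= 1 - d.
Proof.
move=> [[P0 P1] _ bP _]; have [r [sr rr]] := reach_recurrent s DD tD.
rewrite lerBrDr -(P1 s) [leRHS](bigID (recurrent E)) /= addrC /mass lerD2l.
have rr' : recurrent E r := tight_recurrent DD EE tD DE EW tightDW rr.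
by rewrite (bigD1 r) //=; apply: le_trans (bP _ _ sr) _; rewrite lerDl sumr_ge0.
Qed.

(** Along [E], a recurrent state leads to recurrent states only, so that only error entries
    count. *)
Lemma recurrent_escape P s : controlled P -> recurrent E s -> mass P s <= g * d.
Proof.
move=> [_ _ _ bP] rs; rewrite gE mulr_natl -sumr_const /mass.
rewrite [leRHS](bigID (fun t => ~~ recurrent E t)) /= -[leLHS]addr0 lerD ?sumr_ge0 //.
apply: ler_sum => t nt; apply: bP; apply: contra nt => st.
exact: recurrent_step EE rs st.
Qed.

Lemma mass_step A P s : stochastic A -> controlled P ->
  mass (kmul A P) s <= g * d + (1 - d) * mass A s.
Proof.
move=> sA CP; have [A0 A1] := sA.
have -> : mass (kmul A P) s = \sum_x A s x * mass P x.
  rewrite /mass /kmul exchange_big /=; apply: eq_bigr => x _.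
  by rewrite mulr_sumr.
have -> : g * d + (1 - d) * mass A s =
    \sum_x A s x * (g * d + (1 - d) * (~~ recurrent E x)%:R).
  under [RHS]eq_bigr do rewrite mulrDr (mulrCA _ (1 - d)).
  by rewrite big_split /= -mulr_suml A1 mul1r -mulr_sumr -massE.
apply: ler_sum => x _; apply: ler_wpM2l => //.
case: (boolP (recurrent E x)) => [rx|_].
  by rewrite mulr0 addr0; exact: recurrent_escape.
by rewrite mulr1 -[leLHS]add0r lerD ?transient_escape // mulr_ge0 // ltW.
Qed.

(** [g] is the fixed point of the affine bound in [mass_step], so the excess over [g] shrinks by
    [1 - d] per factor. The prefix [A] carries the factors already read. *)
Lemma power_mass m P A s : kernel_power controlled m P -> stochastic A ->
  mass (kmul A P) s - g <= (1 - d) ^+ m * (mass A s - g).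
Proof.
move=> CP; elim: CP A => {m P} [P CP|P m Q CP _ IH] A sA.
  by rewrite expr1; have := mass_step s sA CP; lra.
have [sP _ _ _] := CP.
rewrite kmulA; apply: le_trans (IH _ (stochastic_mul sA sP)) _.
rewrite exprSr -mulrA; apply: ler_wpM2l; first by rewrite exprn_ge0.
by have := mass_step s sA CP; lra.
Qed.

(* The mass outside the [E]-predecessors of [t] can enter them from transient
   states only, where it stays for about [1 / d] steps. *)
Lemma power_to_recurrent m P t : kernel_power controlled m P -> recurrent E t ->
  forall s, ~~ E (s, t) -> P s t <= g.
Proof.
move=> + rt; have tE : tight E W := tight_sup DD EE WW tD DE EW tightDW.
have gd : g * d <= g by rewrite ler_piMr.
elim=> {m P} [P [_ _ _ bP]|P m Q CP CQ IH] s nst.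
  apply: le_trans (bP _ _ nst) (le_trans _ gd); rewrite gE ler_peMl //.
  by rewrite ler1n; apply/card_gt0P; exists s.
have sQ : stochastic Q by apply: power_stochastic CQ => ? [].
have sW : supported W Q by apply: (@power_supported _ m) => //; apply: kernel_power_sub CQ => ? [].
have [[P0 _] _ _ bP] := CP.
(* The errors add up to [#|S| * eps = g * d]. A recurrent [x] outside the predecessors of [t] cannot
   reach [t] along [W], by tightness, and the transient states have mass at most [1 - d]; the total
   is [g * d + (1 - d) * g = g]. *)
apply: (@le_trans _ _ (\sum_x (eps + P s x * (~~ recurrent E x)%:R * g))); last first.
  rewrite big_split /= sumr_const -mulr_natl -gE -mulr_suml -massE.
  by have := ler_wpM2r g0 (transient_escape s CP); lra.
apply: ler_sum => x _; have [xt|nxt] := boolP (E (x, t)).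
  have nsx : ~~ E (s, x) by apply: contra nst => sx; exact: bmx_idem_trans EE sx xt.
  rewrite -[leLHS]addr0 lerD ?mulr_ge0 //.
  by rewrite -[eps]mulr1 ler_pM ?bP ?(stochastic_le1 _ _ sQ) //; case: sQ.
have [rx|_] := boolP (recurrent E x).
  rewrite sW ?mulr0 ?mul0r ?addr0 //; apply: contra nxt => xt.
  by move/recurrentP: rt; apply; exact: tE.
by rewrite mulr1 -[leLHS]add0r lerD // ler_wpM2l // IH.
Qed.

(** A recurrent [t] is covered by [power_to_recurrent]; for a transient one the entry is at most the
    transient mass, whose excess over [g] decays geometrically. *)
Lemma power_sharp_above m P : kernel_power controlled m P ->
  bounded_above (g + (1 - d) ^+ m) (bmx_sharp E) P.
Proof.
move=> CP s t; rewrite bmx_sharpE negb_and => nst.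
have p0 : 0 <= (1 - d) ^+ m by rewrite exprn_ge0.
have [rt|nrt] := boolP (recurrent E t).
  rewrite rt orbF in nst; apply: le_trans (power_to_recurrent CP rt nst) _.
  by rewrite lerDl.
have sP : stochastic P by apply: power_stochastic CP => ? [].
have : P s t <= mass P s.
  by rewrite /mass (bigD1 t) //= lerDl sumr_ge0 // => x _; case: sP.
move/le_trans; apply; have := power_mass s CP stochastic_one; rewrite kmul1.
have m1 : mass kone s <= 1.
  have [k0 k1] := stochastic_one; rewrite -(k1 s) [leRHS](bigID (fun t => ~~ recurrent E t)) /=.
  by rewrite lerDl sumr_ge0.
have : (1 - d) ^+ m * (mass kone s - g) <= (1 - d) ^+ m * 1.
  by apply: ler_wpM2l => //; have := g0; lra.
by lra.
Qed.

End UpperBound.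

End Kernels.

(** * Pure strategies and values *)

Section Plays.
Variables (R : realType) (G : half_blind_game R).
Local Notation kernel := (kernel R (S1 G)).

Definition action_kernel (a : A1 G) (sigma : S2 G -> A2 G) : kernel :=
  fun s t => \sum_y trans1 s a y * trans2 y (sigma y) t.

Fixpoint word_kernel (w : word G) (tau : pure_strategy2 G) : kernel :=
  if w is a :: w' then kmul (action_kernel a (tau 0%N)) (word_kernel w' (fun i => tau i.+1))
  else @kone R (S1 G).

Lemma action_kernel_stochastic a sigma : stochastic (action_kernel a sigma).
Proof.
split=> s; first by move=> t; apply: sumr_ge0 => y _; rewrite mulr_ge0 ?dist_ge0.
rewrite /action_kernel exchange_big /= -(dist_sum1 (trans1 s a)).
by apply: eq_bigr => y _; rewrite -mulr_sumr dist_sum1 mulr1.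
Qed.

Lemma word_kernel_stochastic w tau : stochastic (word_kernel w tau).
Proof.
elim: w tau => [|a w IH] tau; first exact: stochastic_one.
by apply: stochastic_mul => //; exact: action_kernel_stochastic.
Qed.

Definition concat_strategy n (tau tau' : pure_strategy2 G) : pure_strategy2 G :=
  fun i => if (i < n)%N then tau i else tau' (i - n)%N.

Lemma word_kernel_cat w w' tau tau' :
  word_kernel (w ++ w') (concat_strategy (size w) tau tau')
  = kmul (word_kernel w tau) (word_kernel w' tau').
Proof.
elim: w tau => [|a w IH] tau /=.
  by rewrite kmul1; congr word_kernel; apply/funext => i; rewrite /concat_strategy subn0.
by rewrite -kmulA -IH.
Qed.

Lemma word_kernel_split w w' tau :
  word_kernel (w ++ w') tau
  = kmul (word_kernel w tau) (word_kernel w' (fun i => tau (size w + i)%N)).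
Proof. by elim: w tau => [|a w IH] tau /=; rewrite ?kmul1 // IH kmulA. Qed.

(** * Decomposition of plays at the first round *)

Definition shift_strategy (r : round G) (tau : strategy2 G) : strategy2 G :=
  fun h => tau (r :: h.1.1.1, h.1.1.2, h.1.2, h.2).

Definition cons_history n (p : round G * history G n) : history G n.+1 :=
  ([tuple of p.1 :: p.2.1], p.2.2).

Lemma cons_history_bij n : bijective (@cons_history n).
Proof.
exists (fun h => (thead h.1, ([tuple of behead h.1], h.2))).
  by move=> [r [h t]]; rewrite /cons_history /= theadE; congr (_, (_, _)); exact: val_inj.
by move=> [h t]; rewrite /cons_history /= -tuple_eta.
Qed.

Lemma history_prob_cons s a w tau (r : round G) (h : history G (size w)) :
  history_prob (w := a :: w) s tau (cons_history (r, h)) =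
  if (rstate1 r == s) && (ract1 r == a) then
    trans1 s a (rstate2 r) * tau ([::], s, a, rstate2 r) (ract2 r)
    * (trans2 (rstate2 r) (ract2 r) (state_at h 0)
       * history_prob (w := w) (state_at h 0) (shift_strategy r tau) h)
  else 0.
Proof.
rewrite /history_prob /= {1}/state_at /= eqseq_cons eqxx /=.
case: eqP => //= rs; case: eqP => //= ra.
case: eqP => // hw; last by rewrite !mulr0.
rewrite big_ord_recl /= [RHS]mulrA; congr (_ * _).
  by rewrite /history_prefix /= tnth0 rs ra.
apply: eq_bigr => i _ /=.
by rewrite /history_prefix /= !tnthS.
Qed.

Lemma sum_pair (I J : finType) (f : I * J -> R) :
  \sum_p f p = \sum_i \sum_j f (i, j).
Proof. by rewrite pair_bigA /=; apply: eq_bigr => -[]. Qed.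

Lemma prob_at_cons s a w tau t :
  prob_at s (a :: w) tau t = \sum_y \sum_b
    trans1 s a y * tau ([::], s, a, y) b *
    \sum_x trans2 y b x * prob_at x w (shift_strategy (s, a, y, b) tau) t.
Proof.
rewrite /prob_at (reindex (@cons_history (size w))); last exact/onW_bij/cons_history_bij.
rewrite -(pair_big predT (fun h : history G (size w) => h.2 == t)
  (fun r h => history_prob (w := a :: w) s tau (cons_history (r, h)))) /=.
rewrite !sum_pair.
rewrite (bigD1 s) //= [X in _ + X]big1 ?addr0; last first.
  move=> s' ne; apply: big1 => a' _; apply: big1 => y _; apply: big1 => b _; apply: big1 => h _.
  by rewrite history_prob_cons /rstate1 /ract1 /= (negPf ne).
rewrite (bigD1 a) //= [X in _ + X]big1 ?addr0; last first.
  move=> a' ne; apply: big1 => y _; apply: big1 => b _; apply: big1 => h _.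
  by rewrite history_prob_cons /rstate1 /ract1 /= (negPf ne) andbF.
apply: eq_bigr => y _; apply: eq_bigr => b _.
under eq_bigr do rewrite history_prob_cons /rstate1 /ract1 /rstate2 /ract2 /= !eqxx /=.
rewrite -mulr_sumr; congr (_ * _).
under [RHS]eq_bigr do rewrite mulr_sumr.
rewrite exchange_big /=; apply: eq_bigr => h _.
(* The sum over [x] has one nonzero term: a history has probability 0 from any state but its
   first. *)
rewrite (bigD1 (state_at h 0)) //= [X in _ + X]big1 ?addr0 // => x ne.
by rewrite /history_prob eq_sym (negPf ne) /= mulr0.
Qed.

Lemma prob_at_nil s tau t : prob_at (G := G) s [::] tau t = (s == t)%:R.
Proof.
rewrite /prob_at (big_pred1 ([tuple], t)); last first.
  by move=> [h x] /=; rewrite xpair_eqE; case: (h =P _) => // -[]; exact: tuple0.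
rewrite /history_prob /state_at /= eqxx andbT eq_sym; case: eqP => // _.
by rewrite big_ord0.
Qed.

Lemma prob_at_pure s w tau t : prob_at s w (strategy_of_pure tau) t = word_kernel w tau s t.
Proof.
elim: w s tau => [|a w IH] s tau; first exact: prob_at_nil.
rewrite prob_at_cons /= /kmul /action_kernel.
under [RHS]eq_bigr do rewrite mulr_suml.
rewrite [RHS]exchange_big /=; apply: eq_bigr => y _.
rewrite (bigD1 (tau 0%N y)) //= [X in _ + X]big1 ?addr0; last first.
  by move=> b /negPf nb; rewrite nb mulr0 mul0r.
rewrite eqxx mulr1 mulr_sumr; apply: eq_bigr => x _.
by rewrite mulrA -IH.
Qed.

Lemma prob_in_cons s a w tau T :
  prob_in s (a :: w) tau T = \sum_y \sum_b
    trans1 s a y * tau ([::], s, a, y) b *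
    \sum_x trans2 y b x * prob_in x w (shift_strategy (s, a, y, b) tau) T.
Proof.
rewrite /prob_in; under eq_bigr do rewrite prob_at_cons.
rewrite exchange_big /=; apply: eq_bigr => y _.
rewrite exchange_big /=; apply: eq_bigr => b _.
rewrite -mulr_sumr; congr (_ * _); rewrite exchange_big /=.
by apply: eq_bigr => x _; rewrite mulr_sumr.
Qed.

Lemma prob_in_pure s w tau T :
  prob_in s w (strategy_of_pure tau) T = \sum_(t in T) word_kernel w tau s t.
Proof. by apply: eq_bigr => t _; exact: prob_at_pure. Qed.

(* Backward induction: Player 2 observes everything, so a deterministic choice
   depending on the turn and the current state is optimal against a fixed word. *)
Lemma pure_strategy_optimal w T : exists rho : pure_strategy2 G,
  forall s tau, prob_in s w (strategy_of_pure rho) T <= prob_in s w tau T.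
Proof.
have /card_gt0P[b0 _] := A2_nonempty G.
elim: w => [|a w [rho IH]].
  exists (fun _ _ => b0) => s tau.
  by apply: ler_sum => t _; rewrite !prob_at_nil.
pose f y b := \sum_x trans2 y b x * prob_in x w (strategy_of_pure rho) T.
pose sigma y : A2 G := [arg min_(b < b0) f y b]%O.
have sigma_min y b : f y (sigma y) <= f y b.
  by rewrite /sigma; case: arg_minP => // c _; apply.
exists (fun i => if i is i'.+1 then rho i' else sigma) => s tau.
rewrite !prob_in_cons; apply: ler_sum => y _.
rewrite (bigD1 (sigma y)) //= [X in _ + X]big1 ?addr0; last first.
  by move=> b /negPf nb; rewrite nb mulr0 mul0r.
rewrite eqxx mulr1; under [leRHS]eq_bigr do rewrite -mulrA.
rewrite -mulr_sumr; apply: ler_wpM2l; first exact: dist_ge0.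
rewrite -[leLHS]mul1r -(dist_sum1 (tau ([::], s, a, y))) mulr_suml.
apply: ler_sum => b _; apply: ler_wpM2l; first exact: dist_ge0.
apply: le_trans (sigma_min y b) _; apply: ler_sum => x _.
by apply: ler_wpM2l; [exact: dist_ge0|exact: IH].
Qed.

Lemma word_kernel_in w tau s (T : {set S1 G}) :
  0 <= \sum_(t in T) word_kernel w tau s t <= 1.
Proof.
have [P0 P1] := word_kernel_stochastic w tau; rewrite sumr_ge0 //= -(P1 s).
by rewrite [leRHS](bigID (mem T)) /= lerDl sumr_ge0.
Qed.

(** The infimum is attained by the strategy of [pure_strategy_optimal], so that only products of
    kernels remain to be studied. *)
Lemma maxmin_value_eq1 s : maxmin_value (G := G) s = 1 <->
  forall eps, 0 < eps -> exists w : word G, forall tau : pure_strategy2 G,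
    1 - eps <= \sum_(t in final G) word_kernel w tau s t.
Proof.
pose v w := inf (range (fun tau : strategy2 G => prob_in s w tau (final G))).
have v_pure w : exists rho : pure_strategy2 G,
    v w = \sum_(t in final G) word_kernel w rho s t.
  have [rho opt] := pure_strategy_optimal w (final G); exists rho.
  rewrite -prob_in_pure; apply/eqP; rewrite eq_le; apply/andP; split.
    apply: ge_inf; last by exists (strategy_of_pure rho).
    by exists (prob_in s w (strategy_of_pure rho) (final G)) => _ [tau _ <-].
  apply: lb_le_inf; first by exists (prob_in s w (strategy_of_pure rho) (final G)), (strategy_of_pure rho).
  by move=> _ [tau _ <-].
have v_le w (tau : pure_strategy2 G) : v w <= \sum_(t in final G) word_kernel w tau s t.
  have [rho opt] := pure_strategy_optimal w (final G).
  rewrite -prob_in_pure; apply: ge_inf; last by exists (strategy_of_pure tau).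
  by exists (prob_in s w (strategy_of_pure rho) (final G)) => _ [tau' _ <-].
have v1 w : v w <= 1.
  by have [rho ->] := v_pure w; case/andP: (word_kernel_in w rho s (final G)).
have hs : has_sup (range v).
  by split; [exists (v [::]), [::]|exists 1 => _ [w _ <-]].
split=> [s1 eps e0|H].
  have [_ [w _ <-] lt] := sup_adherent e0 hs.
  exists w => tau; apply: le_trans (v_le w tau); apply: ltW; rewrite -s1.
  exact: lt.
apply/eqP; rewrite eq_le; apply/andP; split.
  have [nonempty _] := hs; rewrite -[maxmin_value s]/(sup (range v)).
  by apply: ge_sup => // _ [w _ <-].
apply/ler_addgt0Pr => eps e0; have [w Hw] := H _ e0; rewrite -lerBlDr.
have [rho vE] := v_pure w; apply: le_trans (Hw rho) _; rewrite -vE.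
by apply: ub_le_sup; [case: hs|exists w].
Qed.

Lemma action_bmxE a tau s t : action_bmx a tau (s, t) = (0 < action_kernel a (tau 0%N) s t).
Proof. by rewrite ffunE /= prob_at_pure /= kmulr1. Qed.

End Plays.

Lemma uniform_positive (R : realType) (I : finType) (Q : I -> R -> Prop) (b : R) :
  0 < b -> (forall i d d', 0 < d' -> d' <= d -> Q i d -> Q i d') ->
  (forall i, exists2 d, 0 < d & Q i d) ->
  exists d, [/\ 0 < d, d <= b & forall i, Q i d].
Proof.
move=> b0 Qle H; have /choice[f Hf] : forall i, exists d, 0 < d /\ Q i d.
  by move=> i; have [d d0 Qd] := H i; exists d.
have d0 : 0 < \big[Num.min/b]_i f i by apply: lt_bigmin => // i _; case: (Hf i).
exists (\big[Num.min/b]_i f i); split => //; first exact: bigmin_le_id.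
by move=> i; apply: (Qle i (f i)) => //; [exact: bigmin_le|case: (Hf i)].
Qed.

(** * Monoids of a game *)

Section GameMonoids.
Variables (R : realType) (G : half_blind_game R).
Local Notation S := (S1 G).

Lemma action_supported (a : A1 G) (tau : pure_strategy2 G) :
  supported (action_bmx a tau) (word_kernel [:: a] tau).
Proof.
move=> s t; rewrite action_bmxE /= kmulr1 -leNgt => le0.
by apply/eqP; rewrite eq_le le0 /=; case: (action_kernel_stochastic a (tau 0%N)).
Qed.

Lemma action_bounded_below : exists d : R, [/\ 0 < d, d <= 1 &
  forall a (tau : pure_strategy2 G), bounded_below d (action_bmx a tau) (word_kernel [:: a] tau)].
Proof.
(* The kernel of one letter depends on [tau 0%N] only, so there are finitely many entries to
   bound. *)
pose I := (A1 G * {ffun S2 G -> A2 G} * S * S)%type.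
pose f (i : I) := action_kernel i.1.1.1 i.1.1.2 i.1.2 i.2.
have [|i d d' _ dd Q fi|i|d [d0 d1 Hd]] :=
    @uniform_positive R I (fun i d => 0 < f i -> d <= f i) 1.
- exact: ltr01.
- exact: le_trans dd (Q fi).
- by have [fi|nfi] := ltP 0 (f i); [exists (f i)|exists 1].
exists d; split=> // a tau s t; rewrite action_bmxE /= kmulr1.
have <- : finfun (tau 0%N) = tau 0%N :> (S2 G -> A2 G).
  by apply/funext => y; rewrite ffunE.
exact: (Hd (a, finfun (tau 0%N), s, t)).
Qed.

Lemma total_action (a : A1 G) (tau : pure_strategy2 G) : bmx_total (action_bmx a tau).
Proof.
apply/totalP => s; apply: contrapT => /forallNP none.
have [P0 P1] := action_kernel_stochastic a (tau 0%N).
have := oner_neq0 R; rewrite -(P1 s) big1 ?eqxx // => t _.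
by have := none t; rewrite action_bmxE => /negP; rewrite -leNgt => le0; apply/eqP; rewrite eq_le le0 /=.
Qed.

Lemma markov_total (U : bmx S) : U \in markov_monoid G -> bmx_total U.
Proof.
move: U; apply: generated_ind => [U|U V _ _|U _ UU tU].
- rewrite inE => /orP[/finset.bigcupP[a _]|/set1P ->]; last exact: total_one.
  by rewrite inE => /asboolP[tau ->]; exact: total_action.
- exact: total_mul.
- exact: total_sharp.
Qed.

Lemma belief_total (u : {set bmx S}) U : u \in belief_monoid G -> U \in u -> bmx_total U.
Proof.
move=> /(fintype.subsetP (belief_monoid_sub G)); rewrite inE => /fintype.subsetP uM /uM.
exact: markov_total.
Qed.

Lemma ext_markov_total (x : bmx2 S) : x \in ext_markov_monoid G -> total2 x.
Proof.
move: x; apply: generated_ind => [x|x y _ _|x _ xx tx].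
- rewrite inE => /orP[/finset.bigcupP[a _]|/set1P ->]; last exact: total_one.
  by rewrite inE => /asboolP[tau ->]; exact: total_action.
- exact: total2_mul.
- exact: total2_sharp.
Qed.

Lemma ext_markov_refines (x : bmx2 S) : x \in ext_markov_monoid G -> refines x.1 x.2.
Proof.
move: x; apply: generated_ind => [x|x y _ _|x _ xx rx].
- rewrite inE => /orP[/finset.bigcupP[a _]|/set1P ->]; last exact: refines_refl.
  by rewrite inE => /asboolP[tau ->]; exact: refines_refl.
- exact: refines_mul.
- exact: refines_trans (refines_sharp _) rx.
Qed.

Lemma ext_belief_sub (u : {set bmx2 S}) x : u \in ext_belief_monoid G -> x \in u ->
  x \in ext_markov_monoid G.
Proof.
by move=> /(fintype.subsetP (ext_belief_monoid_sub G)); rewrite inE => /fintype.subsetP; apply.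
Qed.

Lemma ext_belief_mul (u v : {set bmx2 S}) :
  u \in ext_belief_monoid G -> v \in ext_belief_monoid G ->
  set_mul (@bmx2_mul S) u v \in ext_belief_monoid G.
Proof. exact: generated_mul. Qed.

Lemma ext_belief_power (u : {set bmx2 S}) x n : u \in ext_belief_monoid G -> x \in u ->
  power (set_mul (@bmx2_mul S)) u n \in ext_belief_monoid G
  /\ power (@bmx2_mul S) x n \in power (set_mul (@bmx2_mul S)) u n.
Proof.
move=> uB xu; elim: n => //= n [IHB IHx]; split; first exact: ext_belief_mul.
exact: set_mul_in.
Qed.

(** Leaktightness speaks of beliefs; this transfers it to every element of the extended Markov
    monoid. *)
Lemma ext_markov_in_belief (x : bmx2 S) : x \in ext_markov_monoid G ->
  exists2 u, u \in ext_belief_monoid G & x \in u.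
Proof.
move: x; apply: generated_ind => [x|x y _ _ [u uB xu] [v vB yv]|x xM xx [u uB xu]].
- rewrite inE => /orP[/finset.bigcupP[a _ xa]|x1].
    exists (ext_action_belief a) => //; apply: generated_in.
    by rewrite inE; apply/orP; left; exact: imset_f.
  exists [set ext_one G] => //; apply: generated_in.
  by rewrite inE finset.set11 orbT.
- exists (set_mul (@bmx2_mul S) u v); first exact: ext_belief_mul.
  exact: set_mul_in.
(* [u] need not be idempotent, but some power of it is, and that power still contains [x], a power
   of itself. *)
have [n vv] := idempotent_power (set_mulA (@bmx2_mulA S)) u.
have xv : x \in power (set_mul (@bmx2_mul S)) u n.
  suff <- : power (@bmx2_mul S) x n = x by have [] := ext_belief_power n uB xu.
  by elim: (n) => //= k ->.
set v := power _ u n in vv xv.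
have vB : v \in ext_belief_monoid G by have [] := ext_belief_power n uB xu.
exists (set_sharp (@bmx2_mul S) (@bmx2_sharp S) v); first exact: generated_sharp.
apply: (@sharp_in _ _ _ (@total2 S)) => //.
- exact: bmx2_mulA.
- exact: bmx2_sharpL.
- exact: bmx2_sharpR.
- by move=> y yv; apply: ext_markov_total; exact: ext_belief_sub yv.
Qed.

Lemma leaktight_tight (x : bmx2 S) : leaktight G -> x \in ext_markov_monoid G ->
  bmx2_mul x x = x -> tight x.1 x.2.
Proof.
move=> lt xM xx; have [u uB xu] := ext_markov_in_belief xM.
have /bmx2_idemP[x1 x2] := xx.
apply: tight_of_no_leak => //; first exact: ext_markov_total.
  exact: ext_markov_refines.
rewrite -surjective_pairing; apply/negP => lx.
by apply: (lt _ uB); exists x.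
Qed.

(** * Projection of extended beliefs to beliefs *)

Definition proj (u : {set bmx2 S}) : {set bmx S} := [set x.1 | x in u].

Lemma projP (u : {set bmx2 S}) U : reflect (exists W, (U, W) \in u) (U \in proj u).
Proof.
apply: (iffP imsetP) => [[[U' W] xu /= ->]|[W UW]]; first by exists W.
by exists (U, W).
Qed.

Lemma proj_mul u v : proj (set_mul (@bmx2_mul S) u v) = set_mul (@bmx_mul S) (proj u) (proj v).
Proof.
apply/setP => U; apply/projP/set_mulP.
  case=> W /set_mulP[[U1 W1] [[U2 W2] [xu yv [-> _]]]].
  by exists U1, U2; split => //; apply/projP; [exists W1|exists W2].
case=> U1 [U2 [/projP[W1 xu] /projP[W2 yv] ->]].
by exists (bmx_mul W1 W2); apply/set_mulP; exists (U1, W1), (U2, W2).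
Qed.

(* Powers of any lift of [E] are lifts of [E], and one of them is idempotent. *)
Lemma proj_idempotent (u : {set bmx2 S}) E :
  (forall x y, x \in u -> y \in u -> bmx2_mul x y \in u) ->
  E \in proj u -> bmx_mul E E = E -> exists W, (E, W) \in u /\ bmx_mul W W = W.
Proof.
move=> uu /projP[W EW] EE; have [n /bmx2_idemP[_ WW]] := idempotent_power (@bmx2_mulA S) (E, W).
have pu : power (@bmx2_mul S) (E, W) n \in u by elim: (n) => //= k IH; exact: uu.
exists (power (@bmx2_mul S) (E, W) n).2; split => //.
have pE : (power (@bmx2_mul S) (E, W) n).1 = E by elim: (n) => //= k ->.
by move: pu; rewrite {1}(surjective_pairing (power _ _ n)) pE.
Qed.

(** An idempotent of the projection has to be lifted to an idempotent pair before it can be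
    iterated: in [u] for the sandwiches, in the iteration of [u] for the closure. *)
Lemma proj_sharp u : set_mul (@bmx2_mul S) u u = u ->
  proj (set_sharp (@bmx2_mul S) (@bmx2_sharp S) u)
  = set_sharp (@bmx_mul S) (@bmx_sharp S) (proj u).
Proof.
move=> uu; apply/eqP; rewrite finset.eqEsubset; apply/andP; split.
  apply/fintype.subsetP => U /projP[W]; move E : (U, W) => x xu.
  have -> : U = x.1 by rewrite -E.
  move: xu; clear; move: x; apply: generated_ind.
  - move=> _ /sandwichP[x [e [y [xu eu /bmx2_idemP[ee _] yu ->]]]].
    by apply: generated_in; apply/sandwichP; exists x.1, e.1, y.1; rewrite !imset_f.
  - by move=> x y _ _; exact: generated_mul.
  - by move=> x _ /bmx2_idemP[xx _] xv; exact: generated_sharp.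
apply/fintype.subsetP; apply: generated_ind.
- move=> _ /sandwichP[U [E [V [/projP[W1 U1] Eu EE /projP[W2 V2] ->]]]].
  have [|W [EW WW]] := @proj_idempotent u E _ Eu EE.
    by move=> x y xu yu; rewrite -uu set_mul_in.
  apply/projP; exists (bmx_mul (bmx_mul W1 W) W2).
  apply: generated_in; apply/sandwichP; exists (U, W1), (E, W), (V, W2); split => //.
  by apply/bmx2_idemP.
- move=> U V _ _ /projP[W1 U1] /projP[W2 V2]; apply/projP; exists (bmx_mul W1 W2).
  exact: (generated_mul U1 V2).
- move=> E _ EE Eu.
  have [|W [EW WW]] := @proj_idempotent (set_sharp (@bmx2_mul S) (@bmx2_sharp S) u) E _ Eu EE.
    by move=> x y; exact: generated_mul.
  apply/projP; exists W; apply: (generated_sharp (x := (E, W))) => //.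
  by apply/bmx2_idemP.
Qed.

Lemma proj_belief u : u \in ext_belief_monoid G -> proj u \in belief_monoid G.
Proof.
move: u; apply: generated_ind => [u|u v _ _ uB vB|u _ uu uB].
- rewrite inE => /orP[/imsetP[a _ ->]|/set1P ->]; apply: generated_in; rewrite inE.
    apply/orP; left; apply/imsetP; exists a => //; apply/setP => U.
    rewrite [RHS]inE; apply/projP/asboolP => [[W]|[tau ->]].
      by rewrite inE => /asboolP[tau [-> _]]; exists tau.
    by exists (action_bmx a tau); rewrite inE; apply/asboolP; exists tau.
  apply/orP; right; rewrite finset.in_set1; apply/eqP/setP => U.
  apply/projP/idP => [[W]|]; rewrite !finset.in_set1.
    by move=> /eqP[-> _].
  by move=> /eqP ->; exists (bmx_one S); rewrite finset.in_set1.
- by rewrite proj_mul; exact: generated_mul.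
- by rewrite proj_sharp //; apply: generated_sharp => //; rewrite -proj_mul uu.
Qed.

End GameMonoids.

(** * Soundness *)

Section ErrorBounds.
Variable R : realType.

Lemma bernoulli (x : R) n : 0 <= x -> 1 + n%:R * x <= (1 + x) ^+ n.
Proof.
move=> x0; elim: n => [|n IH]; first by rewrite mul0r addr0 expr0.
rewrite exprS -natr1; apply: (@le_trans _ _ ((1 + x) * (1 + n%:R * x))).
  have : 0 <= n%:R * x * x by rewrite !mulr_ge0.
  by lra.
by apply: ler_wpM2l => //; lra.
Qed.

Lemma poly_geometric (K q : R) H eps : 0 <= K -> 0 <= q < 1 -> 0 < eps ->
  exists2 n, (1 < n)%N & K * n%:R ^+ H * q ^+ n <= eps.
Proof.
move=> K0 /andP[q0 q1] e0; pose d := 1 - q; have d0 : 0 < d by rewrite subr_gt0.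
pose C := K * H.+1%:R ^+ H / d ^+ H.+1.
have C0 : 0 <= C by rewrite !mulr_ge0 ?invr_ge0 ?exprn_ge0 // ltW.
pose j := (Num.truncn (C / eps)).+2.
have jC : C <= eps * j%:R.
  rewrite mulrC -ler_pdivrMr //; apply: le_trans (ltW (truncnS_gt _)) _.
  by rewrite ler_nat.
exists (H.+1 * j)%N; first by rewrite /j; lia.
have j0 : 0 < j%:R :> R by rewrite ltr0n.
(* As [q = 1 - d], Bernoulli gives [q^j * (j * d) <= (1 - d^2)^j <= 1]. The power [H.+1] of this
   absorbs [j^H] and leaves [C / j <= eps]. *)
have qj : q ^+ j * (j%:R * d) <= 1.
  apply: (@le_trans _ _ (q ^+ j * (1 + d) ^+ j)).
    by apply: ler_wpM2l; rewrite ?exprn_ge0 //; have := bernoulli j (ltW d0); lra.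
  rewrite -exprMn exprn_ile1 //; first by rewrite mulr_ge0 //; lra.
  by rewrite /d; have := sqr_ge0 (1 - q); nra.
have main : q ^+ (H.+1 * j) * (j%:R * d) ^+ H.+1 <= 1.
  rewrite mulnC exprM -exprMn exprn_ile1 //.
  by apply: mulr_ge0; [exact: exprn_ge0|apply: mulr_ge0; exact: ltW].
have dH : 0 < d ^+ H.+1 by rewrite exprn_gt0.
have -> : K * (H.+1 * j)%:R ^+ H * q ^+ (H.+1 * j)
   = C / j%:R * (q ^+ (H.+1 * j) * (j%:R * d) ^+ H.+1).
  rewrite /C natrM !exprMn (exprS j%:R); field.
  by rewrite !gt_eqF.
apply: le_trans (_ : C / j%:R * 1 <= _).
  by apply: ler_wpM2l => //; rewrite divr_ge0 // ltW.
by rewrite mulr1 ler_pdivrMr.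
Qed.

(** [tree_lower] and [tree_error] iterate the two bounds of [approximates_iter], with [c] standing
    for [#|S|.+1] and [n] for the number of factors beyond which [U] becomes [U^#]. *)
Fixpoint tree_lower (d : R) h := if h is h'.+1 then tree_lower d h' ^+ 2 else d.

Fixpoint tree_error (d e c : R) n h :=
  if h is h'.+1 then c * n%:R * tree_error d e c n h' / tree_lower d h'
                     + (1 - tree_lower d h') ^+ n
  else e.

Lemma tree_lower_in d h : 0 < d <= 1 -> 0 < tree_lower d h <= 1.
Proof.
move=> d01; elim: h => //= h /andP[h0 h1].
by rewrite exprn_gt0 //= exprn_ile1 // ltW.
Qed.

Lemma tree_lower_anti d h h' : 0 < d <= 1 -> (h <= h')%N ->
  tree_lower d h' <= tree_lower d h.
Proof.
move=> d01 /subnK <-; elim: (_ - _)%N => //= k IH; apply: le_trans IH.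
have /andP[k0 k1] := tree_lower_in (k + h) d01.
by rewrite expr2 ler_piMr // ltW.
Qed.

Lemma tree_error_ge0 d e c n h : 0 < d <= 1 -> 0 <= e -> 0 <= c ->
  0 <= tree_error d e c n h.
Proof.
move=> d01 e0 c0; elim: h => //= h IH.
have /andP[h0 h1] := tree_lower_in h d01.
by rewrite addr_ge0 ?exprn_ge0 ?subr_ge0 // divr_ge0 ?mulr_ge0 // ltW.
Qed.

(** The initial error is [q ^+ n], with [q] at least every [1 - tree_lower d h]. Each level then
    multiplies the bound by [2 * c * n / f], so that it ends as a polynomial in [n] times
    [q ^+ n]. *)
Lemma tree_error_small d c H eps : 0 < d <= 1 -> 1 <= c -> 0 < eps ->
  exists n e, [/\ (1 < n)%N, 0 < e & tree_error d e c n H <= eps].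
Proof.
(* Halving keeps [q] positive even if the lower bound is 1; the initial error [q ^+ n] has to be
   positive. *)
move=> d01 c1 eps0; pose f := tree_lower d H / 2; pose q := 1 - f.
have /andP[dH0 dH1] := tree_lower_in H d01.
have f0 : 0 < f by rewrite divr_gt0.
have fdH : f <= tree_lower d H by rewrite /f; lra.
have q0 : 0 < q by rewrite /q /f; lra.
have q1 : q < 1 by rewrite /q; lra.
have c0 : 0 <= c by lra.
have K0 : 0 <= (2 * c / f) ^+ H.
  by apply: exprn_ge0; apply: divr_ge0; [exact: mulr_ge0|exact: ltW].
have [|n n1 nH] := poly_geometric H K0 _ eps0 (q := q); first by rewrite ltW.
exists n, (q ^+ n); split => //; first by rewrite exprn_gt0.
have bound h : (h <= H)%N ->
    tree_error d (q ^+ n) c n h <= (2 * c * n%:R / f) ^+ h * q ^+ n.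
  elim: h => [_|h IH lt]; first by rewrite /= expr0 mul1r.
  have fh : f <= tree_lower d h.
    exact: le_trans fdH (tree_lower_anti d01 (ltnW lt)).
  have /andP[h0 h1] := tree_lower_in h d01.
  have n0 : 1 <= n%:R :> R by rewrite ler1n ltnW.
  set Z := c * n%:R / f.
  have Z1 : 1 <= Z.
    rewrite /Z ler_pdivlMr // mul1r; apply: (@le_trans _ _ 1); first by rewrite /f; lra.
    by rewrite -[leLHS]mulr1 ler_pM.
  have ZE : 2 * c * n%:R / f = 2 * Z by rewrite /Z !mulrA.
  have {}IH := IH (ltnW lt); rewrite ZE in IH *.
  set B := (2 * Z) ^+ h * q ^+ n in IH *.
  have Bq : q ^+ n <= B.
    rewrite /B -[leLHS]mul1r; apply: ler_wpM2r; first by rewrite exprn_ge0 // ltW.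
    by rewrite exprn_ege1 //; lra.
  have B0 : 0 <= B by apply: le_trans Bq; rewrite exprn_ge0 // ltW.
  have -> : (2 * Z) ^+ h.+1 * q ^+ n = Z * B + Z * B by rewrite exprS /B; ring.
  rewrite /=; apply: lerD.
    have E0 : 0 <= tree_error d (q ^+ n) c n h.
      by apply: tree_error_ge0; rewrite ?exprn_ge0 // ltW.
    have -> : Z * B = c * n%:R * B / f by rewrite /Z; ring.
    apply: ler_pM; rewrite ?invr_ge0 ?mulr_ge0 ?(ltW h0) //.
      by apply: ler_wpM2l => //; rewrite mulr_ge0.
    by rewrite lef_pV2 // posrE.
  apply: le_trans (_ : B <= _); last by rewrite ler_peMl.
  apply: le_trans Bq; apply: lerXn2r; rewrite ?nnegrE ?subr_ge0 //; last by rewrite /q; lra.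
  by rewrite /f; lra.
apply: le_trans (bound H (leqnn _)) _; apply: le_trans nH.
by rewrite !exprMn; lra.
Qed.

End ErrorBounds.

Section Soundness.
Variables (R : realType) (G : half_blind_game R).
Hypothesis lt : leaktight G.
Local Notation S := (S1 G).
Local Notation bmul := (@bmx_mul S).
Local Notation bsharp := (@bmx_sharp S).
Local Notation kernel := (kernel R S).

Definition label := (bmx S * bmx2 S)%type.
Definition label_mul (x y : label) : label := (bmul x.1 y.1, bmx2_mul x.2 y.2).
Definition label_one : label := (bmx_one S, (bmx_one S, bmx_one S)).

Lemma label_mulA : associative label_mul.
Proof. by move=> x y z; rewrite /label_mul /= bmx_mulA bmx2_mulA. Qed.

Lemma label_mul1 : left_id label_one label_mul.
Proof. by move=> [x y]; rewrite /label_mul /= bmx_mul1 bmx2_mul1. Qed.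

Lemma label_mulr1 : right_id label_one label_mul.
Proof. by move=> [x y]; rewrite /label_mul /= bmx_mulr1 bmx2_mulr1. Qed.

(* In [(U, (V, W))], entries outside [U] are at most [eps], those in [V] are at
   least [d], and those outside [W] vanish.  Entries in [U] but not in [V] may
   be arbitrarily small: Player 2 chooses how many times to repeat a factor. *)
Record approximates (d eps : R) (x : label) (P : kernel) : Prop := Approximates {
  approx_markov : x.2 \in ext_markov_monoid G;
  approx_low : refines x.2.1 x.1;
  approx_up : refines x.1 x.2.2;
  approx_supp : supported x.2.2 P;
  approx_below : bounded_below d x.2.1 P;
  approx_above : bounded_above eps x.1 P
}.

Lemma approximates_le d d' eps eps' x P : d' <= d -> eps <= eps' ->
  approximates d eps x P -> approximates d' eps' x P.
Proof.
move=> dd ee [? ? ? ? bP aP]; split => //; first exact: bounded_below_le bP.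
exact: bounded_above_le aP.
Qed.

Lemma approximates_mul d eps eps' x x' P P' d' : 0 <= d -> 0 <= d' -> 0 <= eps -> 0 <= eps' ->
  stochastic P -> stochastic P' ->
  approximates d eps x P -> approximates d' eps' x' P' ->
  approximates (d * d') (#|S|%:R * eps + eps') (label_mul x x') (kmul P P').
Proof.
move=> d0 d0' e0 e0' sP sP' [m1 l1 u1 s1 b1 a1] [m2 l2 u2 s2 b2 a2]; split => /=.
- exact: generated_mul.
- exact: refines_mul.
- exact: refines_mul.
- exact: supported_mul.
- exact: bounded_below_mul.
- exact: bounded_above_mul.
Qed.

Lemma refines_sharp2 (D E W : bmx S) : bmul D D = D -> bmul E E = E -> bmx_total D ->
  refines D E -> refines E W -> tight D W -> refines (bsharp D) (bsharp E).
Proof.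
move=> DD EE tD DE EW tDW; apply/refinesP => s t; rewrite !bmx_sharpE => /andP[st rt].
rewrite (tight_recurrent DD EE tD DE EW tDW rt) andbT.
by move/refinesP: DE; apply.
Qed.

Lemma label_idemP (e : label) : label_mul e e = e ->
  [/\ bmul e.1 e.1 = e.1, bmx2_mul e.2 e.2 = e.2,
      bmul e.2.1 e.2.1 = e.2.1 & bmul e.2.2 e.2.2 = e.2.2].
Proof.
move=> ee; have e1 : bmul e.1 e.1 = e.1 := congr1 fst ee.
have e2 : bmx2_mul e.2 e.2 = e.2 := congr1 snd ee.
by have /bmx2_idemP[? ?] := e2.
Qed.

(** [V^#] is justified for every [m] by the uniform lower bound. For [m <= n], keeping [U] costs an
    error linear in [m]; beyond that, the entries outside [U^#] have decayed to at most
    [#|S| * eps / d + (1 - d) ^+ n]. *)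
Lemma approximates_iter n d eps e m P : 0 < d <= 1 -> 0 <= eps -> (0 < n)%N ->
  label_mul e e = e ->
  kernel_power (fun P => approximates d eps e P /\ stochastic P) m P ->
  approximates (d ^+ 2)
    (#|S|.+1%:R * n%:R * eps / d + (1 - d) ^+ n)
    (if (m <= n)%N then e.1 else bsharp e.1, bmx2_sharp e.2) P.
Proof.
move=> /andP[d0 d1] e0 n0 /label_idemP[EE ee DD WW] eP.
have [P' [[eM DE EW _ _ _] _]] : exists P', approximates d eps e P' /\ stochastic P'.
  by case: eP => {m P} [P'|P' m Q] ?; [exists P'|exists P'].
have tD := ext_markov_total eM; have tDW := leaktight_tight lt eM ee.
have DW := refines_trans DE EW.
have d01 : 0 <= d <= 1 by rewrite d1 ltW.
split => /=.
- exact: generated_sharp.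
- case: ifP => _; last exact: refines_sharp2 EW _.
  exact: refines_trans (refines_sharp _) DE.
- by case: ifP => _ //; exact: refines_trans (refines_sharp _) EW.
- by apply: (@power_supported _ _ _ m) => //; apply: kernel_power_sub eP => ? [[]].
- apply: (@power_sharp_below _ _ _ e.2.2 _ _ _ _ _ _ _ m) => //.
  by apply: kernel_power_sub eP => ? [[]].
have n1 : 1 <= n%:R :> R by rewrite ler1n.
have c1 : 1 <= #|S|.+1%:R :> R by rewrite ler1n.
have q0 k : 0 <= (1 - d) ^+ k by rewrite exprn_ge0 // subr_ge0.
have dV : 1 <= d^-1 by rewrite invf_ge1.
case: leqP => [mn|nm].
  apply: bounded_above_le (_ : bounded_above (m%:R * (#|S|.+1%:R * eps)) e.1 P); last first.
    by apply: power_bounded_above => //; apply: kernel_power_sub eP => ? [[]].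
  apply: (@le_trans _ _ (n%:R * (#|S|.+1%:R * eps))).
    by apply: ler_wpM2r; rewrite ?mulr_ge0 // ler_nat.
  rewrite mulrA (mulrC n%:R) -[leLHS]addr0 lerD // ler_peMr // !mulr_ge0 //.
pose g := #|S|%:R * eps / d.
apply: bounded_above_le (_ : bounded_above (g + (1 - d) ^+ m) (bsharp e.1) P); last first.
  apply: (@power_sharp_above _ _ e.2.1 e.1 e.2.2 d eps) => //.
    by rewrite /g divfK // gt_eqF.
  by apply: kernel_power_sub eP => ? [[]].
apply: lerD; last first.
  by apply: ler_wiXn2l => //; [rewrite subr_ge0|lra|exact: ltnW].
rewrite /g; apply: ler_wpM2r; first by rewrite invr_ge0 ltW.
apply: ler_wpM2r => //; rewrite -[leLHS]mulr1; apply: ler_pM => //.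
by rewrite ler_nat.
Qed.

(** The lower bound [d] is chosen before [eps]: the iteration picks its accuracy depending on
    [d]. *)
Definition reified (u : {set bmx S}) := exists d, 0 < d <= 1 /\ forall eps, 0 < eps ->
  exists w : word G, forall tau, exists x : label,
    x.1 \in u /\ approximates d eps x (word_kernel w tau).

(** * Repetition of one word: factorization of the choices of Player 2 *)

Section Iteration.
Variables (u : {set bmx S}) (w : word G).
Hypotheses (uB : u \in belief_monoid G) (uu : set_mul bmul u u = u).

Local Notation v := (set_sharp bmul bsharp u).

(** The letters to be factorized are pure strategies, one for each copy of [w], since Player 2 may
    play differently in each copy. *)
Fixpoint run_kernel (l : seq (pure_strategy2 G)) : kernel :=
  if l is tau :: l' then kmul (word_kernel w tau) (run_kernel l') else @kone R S.

Lemma run_kernel_cat l l' : run_kernel (l ++ l') = kmul (run_kernel l) (run_kernel l').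
Proof. by elim: l => [|tau l IH] /=; rewrite ?kmul1 // IH kmulA. Qed.

Lemma run_kernel_stochastic l : stochastic (run_kernel l).
Proof.
elim: l => [|tau l IH]; first exact: stochastic_one.
exact: stochastic_mul (word_kernel_stochastic _ _) IH.
Qed.

Lemma word_kernel_nseq N tau : exists l,
  size l = N /\ word_kernel (flatten (nseq N w)) tau = run_kernel l.
Proof.
elim: N tau => [|N IH] tau; first by exists [::].
have [l [sl lE]] := IH (fun i => tau (size w + i)%N).
by exists (tau :: l); rewrite /= word_kernel_split lE sl.
Qed.

Let uT U : U \in u -> bmx_total U.
Proof. exact: belief_total uB. Qed.

Let vu U V : U \in v -> V \in u -> bmul U V \in v.
Proof.
apply: (set_sharp_mulr (tot := @bmx_total S)) => //.
- exact: bmx_mulA.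
- exact: total_mul.
- exact: total_sharp.
- exact: bmx_sharpR.
Qed.

Let uv U V : U \in u -> V \in v -> bmul U V \in v.
Proof.
apply: (set_sharp_mull (tot := @bmx_total S)) => //.
- exact: bmx_mulA.
- exact: total_mul.
- exact: total_sharp.
- by move=> e _; exact: bmx_sharpL.
Qed.

Let sharp_v E : bmul E E = E -> E \in u \/ E \in v -> bsharp E \in v.
Proof.
move=> EE [Eu|]; last by move=> Ev; exact: generated_sharp.
apply: (sharp_in (tot := @bmx_total S)) => //.
- exact: bmx_mulA.
- by move=> e _; exact: bmx_sharpL.
- exact: bmx_sharpR.
Qed.

Variables (n : nat) (d eps : R).
Hypotheses (n1 : (1 < n)%N) (d01 : 0 < d <= 1) (eps0 : 0 < eps).
Hypothesis wP : forall tau, exists x : label,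
  x.1 \in u /\ approximates d eps x (word_kernel w tau).

Let dl := tree_lower d.
Let er := tree_error d eps #|S|.+1%:R n.

(** As long as [U] stays in [u], each level multiplies the length by at most [n]; more than [n ^ h]
    letters thus force membership in [v]. *)
Definition counted h (l : seq (pure_strategy2 G)) U :=
  ((size l <= n ^ h)%N /\ U \in u) \/ U \in v.

Definition tree_label h l (x : label) :=
  approximates (dl h) (er h) x (run_kernel l) /\ counted h l x.1.

Let dl0 h : 0 < dl h. Proof. by case/andP: (tree_lower_in h d01). Qed.
Let dl1 h : dl h <= 1. Proof. by case/andP: (tree_lower_in h d01). Qed.
Let er0 h : 0 <= er h. Proof. by apply: tree_error_ge0 => //; exact: ltW. Qed.

Let erS h (k : nat) : (k <= #|S|.+1 * n)%N -> k%:R * er h <= er h.+1.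
Proof.
move=> kle; rewrite /er /= -/(er h) -/(dl h) -[leLHS]addr0 lerD //; last first.
  by rewrite exprn_ge0 // subr_ge0.
rewrite -[leLHS]mulr1 ler_pM ?mulr_ge0 ?invf_ge1 //.
by rewrite -natrM ler_wpM2r // ler_nat.
Qed.

Lemma tree_label_mono h l x : tree_label h l x -> tree_label h.+1 l x.
Proof.
move=> [ax cx]; split.
  apply: approximates_le ax; first exact: tree_lower_anti.
  by rewrite -[leLHS]mul1r; apply: (@erS h 1); lia.
case: cx => [[lx xu]|]; [left; split => //|by right].
by apply: leq_trans lx _; rewrite leq_exp2l.
Qed.

Lemma tree_label_prod h l l' x x' : tree_label h l x -> tree_label h l' x' ->
  tree_label h.+1 (l ++ l') (label_mul x x').
Proof.
move=> [ax cx] [ax' cx']; split.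
  rewrite run_kernel_cat.
  have := approximates_mul (ltW (dl0 h)) (ltW (dl0 h)) (er0 h) (er0 h)
    (run_kernel_stochastic l) (run_kernel_stochastic l') ax ax'.
  apply: approximates_le; first by rewrite -expr2.
  by rewrite -{2}[er h]mul1r -mulrDl natr1; apply: erS; rewrite leq_pmulr // ltnW.
case: cx cx' => [[lx xu]|xv] [[lx' xu']|xv'].
- left; rewrite size_cat expnS -uu set_mul_in //; split => //.
  (* A product node doubles the length at most, and [n] is at least 2. *)
  by have := leq_mul n1 (leqnn (n ^ h)); lia.
- by right; exact: uv.
- by right; exact: vu.
- by right; exact: generated_mul.
Qed.

Lemma tree_label_power h e m l : iterate tree_label h e m l ->
  kernel_power (fun P => approximates (dl h) (er h) e P /\ stochastic P) m (run_kernel l)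
  /\ (((size l <= m * n ^ h)%N /\ e.1 \in u) \/ e.1 \in v).
Proof.
elim=> {m l} [l [al cl]|l m l' [al cl] _ [pl' cl']].
  split; last by rewrite mul1n.
  by apply: KernelPower1; split => //; exact: run_kernel_stochastic.
rewrite run_kernel_cat; split.
  by apply: KernelPowerS => //; split => //; exact: run_kernel_stochastic.
case: cl cl' => [[sl eu]|]; last by right.
by case=> [[sl' _]|]; [left; rewrite size_cat mulSn leq_add|right].
Qed.

Lemma tree_label_iter h e m l : label_mul e e = e -> iterate tree_label h e m l ->
  exists y, [/\ tree_label h.+1 l y, label_mul e y = y, label_mul y e = y
    & label_mul y y = y].
Proof.
move=> ee /tree_label_power[pl cl].
have [EE e2 _ _] := label_idemP ee.
have n0 : (0 < n)%N by exact: ltnW.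
have [eM DE] : e.2 \in ext_markov_monoid G /\ refines e.2.1 e.1.
  by case: pl => {l m cl} [P [[]]|P m Q [[]]].
have t2 := ext_markov_total eM.
have tE : bmx_total e.1.
  apply/totalP => s; have /totalP/(_ s)[t st] := t2.
  by exists t; move/refinesP: DE; apply.
have dh : 0 < dl h <= 1 by rewrite dl0 dl1.
(* The threshold of [approximates_iter] also settles the count: up to [n] factors have at most
   [n ^ h.+1] letters, and more of them put [bsharp e.1] in [v]. *)
exists (if (m <= n)%N then e.1 else bsharp e.1, bmx2_sharp e.2); split.
- split; first exact: approximates_iter.
  rewrite /counted /=; case: (leqP m n) => mn.
    case: cl => [[sl eu]|]; [left; split => //|by right].
    by apply: leq_trans sl _; rewrite expnS leq_mul2r mn orbT.
  by right; apply: sharp_v => //; case: cl => [[_ eu]|]; [left|right].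
- rewrite /label_mul /= bmx2_sharpL //; case: ifP => _; rewrite ?EE //.
  by rewrite bmx_sharpL.
- rewrite /label_mul /= bmx2_sharpR //; case: ifP => _; rewrite ?EE //.
  by rewrite bmx_sharpR.
- rewrite /label_mul /= bmx2_sharp_idem //; case: ifP => _; rewrite ?EE //.
  by rewrite bmx_sharp_idem.
Qed.

Lemma tree_label_letter tau : exists x, tree_label 0 [:: tau] x.
Proof.
have [x [xu ax]] := wP tau; exists x; split; last by left.
by rewrite /= kmulr1.
Qed.

End Iteration.

Lemma reified_sharp (u : {set bmx S}) : u \in belief_monoid G ->
  set_mul bmul u u = u -> reified u -> reified (set_sharp bmul bsharp u).
Proof.
move=> uB uu [d [d01 Hu]].
have [H fact] := factorization label_mulA label_mul1 label_mulr1.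
exists (tree_lower d H); split; first exact: tree_lower_in.
move=> eps eps0.
have c1 : 1 <= #|S|.+1%:R :> R by rewrite ler1n.
(* [n] and [e] depend on [d] and [eps] only; [w] is chosen afterwards, with accuracy [e]. *)
have [n [e [n1 e0 small]]] := tree_error_small H d01 c1 eps0.
have [w wP] := Hu e e0.
(* One copy more than [n ^ H] rules out the first alternative of [counted]. *)
exists (flatten (nseq (n ^ H).+1 w)) => tau.
have [l [sl ->]] := word_kernel_nseq w (n ^ H).+1 tau.
have [|||||x [ax cx]] := fact _ (tree_label u w n d e) _ _ _ _ l _.
- by move=> h l' x; exact: tree_label_mono.
- by move=> h l1 l2 x x'; exact: tree_label_prod.
- by move=> h x m l'; exact: tree_label_iter.
- by move=> tau'; exact: tree_label_letter.
- by move=> l0; move: sl; rewrite l0.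
exists x; split; first by case: cx => // -[]; rewrite sl ltnn.
exact: approximates_le ax.
Qed.

Lemma belief_reified u : u \in belief_monoid G -> reified u.
Proof.
move: u; apply: generated_ind => [u|u v uB vB [d [d01 Hu]] [d' [d01' Hv]]|u uB uu]; last 2 first.
- have /andP[d0 d1] := d01; have /andP[d0' d1'] := d01'.
  exists (d * d'); split; first by rewrite mulr_gt0 //= mulr_ile1 // ltW.
  (* A product turns two errors [e] into [#|S|.+1 * e]. *)
  move=> eps eps0; pose e := eps / #|S|.+1%:R.
  have e0 : 0 < e by rewrite divr_gt0 // ltr0n.
  have [w Hw] := Hu e e0; have [w' Hw'] := Hv e e0.
  exists (w ++ w') => tau; rewrite word_kernel_split.
  have [x [xu ax]] := Hw tau; have [x' [xv ax']] := Hw' (fun i => tau (size w + i)%N).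
  exists (label_mul x x'); split; first exact: set_mul_in.
  have := approximates_mul (ltW d0) (ltW d0') (ltW e0) (ltW e0)
    (word_kernel_stochastic _ _) (word_kernel_stochastic _ _) ax ax'.
  by apply: approximates_le => //; rewrite -{2}[e]mul1r -mulrDl natr1 /e mulrC divfK ?pnatr_eq0.
- exact: (reified_sharp uB uu).
- have [d [d0 d1 Hd]] := action_bounded_below G.
  rewrite inE => /orP[/imsetP[a _ ->]|/set1P ->].
    exists d; rewrite d0 d1; split => // eps eps0; exists [:: a] => tau.
    pose U := action_bmx a tau.
    have supp : supported U (word_kernel [:: a] tau) by exact: action_supported.
    exists (U, (U, U)); split; first by rewrite inE; apply/asboolP; exists tau.
    split => //=; try exact: refines_refl.
      apply: generated_in; rewrite inE; apply/orP; left.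
      apply/finset.bigcupP; exists a => //; rewrite inE; apply/asboolP; by exists tau.
      exact: Hd.
    by move=> s t nU; have /= -> := supp s t nU; exact: ltW.
  exists 1; rewrite ltr01 lexx; split => // eps eps0; exists [::] => tau.
  exists label_one; split; first exact: finset.set11.
  split => //=; try exact: refines_refl.
  - by apply: generated_in; rewrite inE finset.set11 orbT.
  - by move=> s t; rewrite ffunE /kone /= => /negPf ->.
  - by move=> s t; rewrite ffunE /kone /= => ->.
  - by move=> s t; rewrite ffunE /kone /= => /negPf ->; exact: ltW.
Qed.

(** For a witness, the entries from [s] to states outside [final G] lie outside [U], so the mass
    missed is at most [#|S|] times the error. *)
Lemma witness_value s u : u \in belief_monoid G -> reachability_witness s u ->
  maxmin_value s = 1.
Proof.
move=> uB wit; apply/maxmin_value_eq1 => eps eps0.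
have [d [_ Hu]] := belief_reified uB.
have e0 : 0 < eps / #|S|.+1%:R by rewrite divr_gt0 // ltr0n.
have [w Hw] := Hu _ e0; exists w => tau.
have [x [xu ax]] := Hw tau.
have [P0 P1] := word_kernel_stochastic w tau.
rewrite lerBlDr -(P1 s) (bigID (mem (final G))) /= lerD2l.
apply: (@le_trans _ _ (\sum_(t : S) eps / #|S|.+1%:R)); last first.
  rewrite sumr_const -[leLHS]mulr_natl mulrA ler_pdivrMr ?ltr0n // mulrC ler_wpM2l ?(ltW eps0) //.
  by rewrite ler_nat.
rewrite [leRHS](bigID (fun t => t \notin final G)) /= -[leLHS]addr0 lerD //.
  apply: ler_sum => t tF; apply: approx_above ax _ _ _.
  by apply: contra tF; exact: wit.
by apply: sumr_ge0 => t _; exact: ltW.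
Qed.

End Soundness.

(** * Completeness *)

Section IterateSplit.
Variables (M : finType) (A : Type) (T : nat -> seq A -> M -> Prop).

Lemma iterate_sub (T' : nat -> seq A -> M -> Prop) h h' e m w :
  (forall v, T h v e -> T' h' v e) -> iterate T h e m w -> iterate T' h' e m w.
Proof.
move=> TT; elim=> {m w} [v /TT|v m w /TT Tv _]; first exact: Iterate1.
exact: IterateS.
Qed.

Lemma iterateP h e m w : iterate T h e m w ->
  if m is m'.+1 then
    if m' is 0 then T h w e
    else exists v w', [/\ w = v ++ w', T h v e & iterate T h e m' w']
  else False.
Proof. by case=> {m w} // v [|m] w Tv Iw; [inversion Iw|exists v, w]. Qed.

Lemma iterate_split h e a b w : iterate T h e (a.+1 + b.+1) w ->
  exists w1 w2, [/\ w = w1 ++ w2, iterate T h e a.+1 w1 & iterate T h e b.+1 w2].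
Proof.
elim: a w => [|a IH] w.
  by move=> /iterateP[v [w' [-> Tv Iw']]]; exists v, w'; split => //; exact: Iterate1.
rewrite addSn => /iterateP; rewrite addSn => -[v [w' [-> Tv /IH[w1 [w2 [-> I1 I2]]]]]].
by exists (v ++ w1), w2; rewrite catA; split => //; exact: IterateS.
Qed.

End IterateSplit.

Section Completeness.
Variables (R : realType) (G : half_blind_game R).
Hypothesis lt : leaktight G.
Local Notation S := (S1 G).
Local Notation mul2 := (@bmx2_mul S).
Local Notation sharp2 := (@bmx2_sharp S).

Definition realizes (d : R) (x : bmx2 S) (w : word G) := exists tau,
  supported x.2 (word_kernel w tau) /\ bounded_below d x.1 (word_kernel w tau).

Definition realizes_all (d : R) (w : word G) (u : {set bmx2 S}) :=
  forall x, x \in u -> realizes d x w.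

Lemma realizes_le d d' x w : d' <= d -> realizes d x w -> realizes d' x w.
Proof. by move=> dd [tau [sP bP]]; exists tau; split => //; exact: bounded_below_le bP. Qed.

Lemma realizes_refines d x y w : refines y.1 x.1 -> y.2 = x.2 ->
  realizes d x w -> realizes d y w.
Proof.
move=> yx e [tau [sP bP]]; exists tau; rewrite e; split => //.
exact: bounded_below_refines bP.
Qed.

Lemma realizes_mul d d' x y w w' : 0 <= d -> 0 <= d' ->
  realizes d x w -> realizes d' y w' -> realizes (d * d') (mul2 x y) (w ++ w').
Proof.
move=> d0 d0' [tau [sP bP]] [tau' [sP' bP']].
exists (concat_strategy (size w) tau tau'); rewrite word_kernel_cat; split.
  exact: supported_mul.
by apply: bounded_below_mul => //; exact: word_kernel_stochastic.
Qed.

(** With a predicate that ignores the height, [iterate] describes plain concatenations of [m]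
    words. *)
Definition repeated d u := iterate (fun=> realizes_all d) 0 u.

Lemma repeated_gt0 d u m w : repeated d u m w -> (0 < m)%N.
Proof. by case. Qed.

(** * Strategies of Player 2 that realize the iteration of an extended belief *)

Section SharpRealized.
Variables (u : {set bmx2 S}) (d : R).
Hypotheses (uB : u \in ext_belief_monoid G) (uu : set_mul mul2 u u = u) (d01 : 0 < d <= 1).

Let d0 : 0 <= d. Proof. by case/andP: d01 => /ltW. Qed.
Let d1 : d <= 1. Proof. by case/andP: d01. Qed.
Let uM x : x \in u -> x \in ext_markov_monoid G. Proof. exact: ext_belief_sub. Qed.
Let umul x y : x \in u -> y \in u -> mul2 x y \in u.
Proof. by move=> xu yu; rewrite -uu set_mul_in. Qed.

(** This bound degrades with [m]; it is applied to one or two factors. *)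
Lemma repeated_realizes m w x : repeated d u m w -> x \in u -> realizes (d ^+ m) x w.
Proof.
move=> I; elim: I x => {m w} [w Tw|v m w Tv _ IH] x; first exact: Tw.
rewrite -{1}uu => /set_mulP[y [z [yu zu ->]]]; rewrite exprS.
by apply: realizes_mul; rewrite ?exprn_ge0 //; [exact: Tv|exact: IH].
Qed.

Lemma repeated_sharp m w e : repeated d u m w -> e \in u -> mul2 e e = e ->
  realizes (d ^+ 2) (sharp2 e) w.
Proof.
move=> I eu ee; have eM := uM eu; have /bmx2_idemP[e1 e2] := ee.
have [tau Ptau] : exists tau, kernel_power (fun P : kernel R S =>
    [/\ stochastic P, supported e.2 P & bounded_below d e.1 P]) m (word_kernel w tau).
  elim: I => {m w} [w Tw|v m w Tv _ [tau' IH]].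
    have [tau [sP bP]] := Tw _ eu; exists tau; apply: KernelPower1.
    by split => //; exact: word_kernel_stochastic.
  have [tau [sP bP]] := Tv _ eu; exists (concat_strategy (size v) tau tau').
  rewrite word_kernel_cat; apply: KernelPowerS => //.
  by split => //; exact: word_kernel_stochastic.
exists tau; split => /=.
  by apply: (@power_supported _ _ _ m) => //; apply: kernel_power_sub Ptau => ? [].
apply: (@power_sharp_below _ _ e.1 e.2 _ _ _ _ _ _ _ m) => //.
- exact: ext_markov_total.
- exact: ext_markov_refines.
- exact: leaktight_tight.
- by rewrite d0.
Qed.

(** The bound [d'] has to serve all [m]. A product needs two factors to be split over, so the
    induction also provides an element of [u] above [y], which is realized instead when there is a
    single factor. *)
Lemma set_sharp_realized y : y \in set_sharp mul2 sharp2 u ->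
  (exists x, [/\ x \in u, refines y.1 x.1 & y.2 = x.2]) /\
  exists2 d', 0 < d' & forall m w, repeated d u m w -> realizes d' y w.
Proof.
have dgt0 : 0 < d by case/andP: d01.
move: y; apply: set_sharp_ind => [x e z xu eu ee zu|y y' _ _ [[x [xu yx ex]] [c c0 Hc]]
    [[x' [xu' yx' ex']] [c' c0' Hc']]|y _ yy [[x [xu yx ex]] [c c0 Hc]]].
- set y := mul2 _ _; pose x0 := mul2 (mul2 x e) z.
  have yx0 : refines y.1 x0.1.
    by apply: refines_mul (refines_refl _); apply: refines_mul (refines_refl _) (refines_sharp _).
  have x0u : x0 \in u by rewrite !umul.
  split; first by exists x0.
  (* With three factors or more, the first realizes [x], the last [z] and those between them
     [sharp2 e], with bounds [d], [d] and [d ^+ 2]. *)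
  exists (d ^+ 4); first by rewrite exprn_gt0.
  move=> [|[|[|m]]] w Iw; first by have := repeated_gt0 Iw.
  + apply: (realizes_refines yx0) => //; apply: realizes_le (repeated_realizes Iw x0u).
    by apply: ler_wiXn2l.
  + apply: (realizes_refines yx0) => //; apply: realizes_le (repeated_realizes Iw x0u).
    by apply: ler_wiXn2l.
  + have /iterate_split[w1 [w' [-> I1]]] : repeated d u (0.+1 + m.+2)%N w by [].
    rewrite -addn1 => /iterate_split[w2 [w3 [-> I2 I3]]].
    rewrite catA; apply: (@realizes_le (d ^+ 1 * d ^+ 2 * d ^+ 1)).
      by rewrite -!exprD.
    apply: realizes_mul; rewrite ?mulr_ge0 ?exprn_ge0 //; last exact: repeated_realizes I3 zu.
    apply: realizes_mul; rewrite ?exprn_ge0 //; first exact: repeated_realizes I1 xu.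
    exact: repeated_sharp I2 eu ee.
- split.
    exists (mul2 x x'); split; rewrite ?umul //; first exact: refines_mul.
    by rewrite /= ex ex'.
  (* A single factor realizes [mul2 x x']; otherwise the first one realizes [y] and the rest
     [y']. *)
  exists (Num.min d (c * c')); first by rewrite lt_min dgt0 mulr_gt0.
  move=> [|[|m]] w Iw; first by have := repeated_gt0 Iw.
    apply: (@realizes_refines _ (mul2 x x')); rewrite /= ?ex ?ex' //; first exact: refines_mul.
    by apply: realizes_le (repeated_realizes Iw (umul xu xu')); rewrite expr1 ge_min lexx.
  have /iterate_split[w1 [w2 [-> I1 I2]]] : repeated d u (0.+1 + m.+1)%N w by [].
  apply: (@realizes_le (c * c')); last first.
    by apply: realizes_mul (Hc _ _ I1) (Hc' _ _ I2); exact: ltW.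
  by rewrite ge_min lexx orbT.
- split.
    by exists x; split => //; exact: refines_trans (refines_sharp _) yx.
  (* Iterating [y] removes entries from its first component and keeps the second, so the same
     strategy works. *)
  exists c => // m w /Hc; apply: realizes_refines => //; exact: refines_sharp.
Qed.

End SharpRealized.

(** There are finitely many pairs of a belief and an element. Keeping the bound below [d ^+ 2] lets
    one sequence of bounds serve products as well. *)
Lemma sharp_realized d : 0 < d <= 1 -> exists d', [/\ 0 < d', d' <= d ^+ 2 &
  forall u, u \in ext_belief_monoid G -> set_mul mul2 u u = u ->
    forall m w, repeated d u m w -> realizes_all d' w (set_sharp mul2 sharp2 u)].
Proof.
move=> d01; have /andP[d0 _] := d01.
pose Q (i : {set bmx2 S} * bmx2 S) d' := i.1 \in ext_belief_monoid G ->
  set_mul mul2 i.1 i.1 = i.1 -> i.2 \in set_sharp mul2 sharp2 i.1 ->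
  forall m w, repeated d i.1 m w -> realizes d' i.2 w.
have [||[u y]|d' [d0' d2 Hd']] := @uniform_positive R _ Q (d ^+ 2).
- by rewrite exprn_gt0.
- by move=> i c c' _ cc Qc uB uu yu m w I; apply: realizes_le cc (Qc uB uu yu m w I).
- have [[/= uB uu yu]|nH] := pselect [/\ u \in ext_belief_monoid G,
      set_mul mul2 u u = u & y \in set_sharp mul2 sharp2 u].
    by have [_ [c c0 Hc]] := set_sharp_realized uB uu d01 yu; exists c => // _ _ _.
  by exists 1 => // uB uu yu; case: nH.
exists d'; split => // u uB uu m w I y yu; exact: (Hd' (u, y)) I.
Qed.

Lemma value_witness s : maxmin_value (G := G) s = 1 ->
  exists2 u, u \in belief_monoid G & reachability_witness s u.
Proof.
move/maxmin_value_eq1 => val1.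
have [H fact] := factorization (set_mulA (@bmx2_mulA S)) (set_mul1 (@bmx2_mul1 S))
  (set_mulr1 (@bmx2_mulr1 S)).
have [d0 [d00 d01 Hd0]] := action_bounded_below G.
have /choice[g Hg] : forall d, exists d', 0 < d <= 1 -> [/\ 0 < d', d' <= d ^+ 2 &
    forall u, u \in ext_belief_monoid G -> set_mul mul2 u u = u ->
    forall m w, repeated d u m w -> realizes_all d' w (set_sharp mul2 sharp2 u)].
  move=> d; have [d1|nd1] := pselect (0 < d <= 1); last by exists 0.
  by have [d' Hd'] := sharp_realized d1; exists d'.
(* [dl h] is the bound guaranteed by trees of height [h], whatever the word. *)
pose dl h := iter h g d0.
have dlP h : 0 < dl h <= 1.
  elim: h => [|h IH] /=; first by rewrite d00.
  have [-> le _] := Hg _ IH; apply: le_trans le _; case/andP: IH => h0 h1.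
  by rewrite exprn_ile1 // ltW.
have dlS h : dl h.+1 <= dl h ^+ 2 by case: (Hg _ (dlP h)).
have dl0 h : 0 <= dl h by case/andP: (dlP h) => /ltW.
have dl1 h : dl h <= 1 by case/andP: (dlP h).
pose T h (w : word G) u := u \in ext_belief_monoid G /\ realizes_all (dl h) w u.
have tot u x : u \in ext_belief_monoid G -> x \in u -> total2 x.
  by move=> uB xu; apply: ext_markov_total; exact: ext_belief_sub xu.
have Tmono h w u : T h w u -> T h.+1 w u.
  move=> [uB Hw]; split => // x xu; apply: realizes_le (Hw x xu).
  by apply: le_trans (dlS h) _; rewrite expr2 ler_piMr.
have Tprod h w w' u u' : T h w u -> T h w' u' -> T h.+1 (w ++ w') (set_mul mul2 u u').
  move=> [uB Hw] [uB' Hw']; split; first exact: ext_belief_mul.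
  move=> _ /set_mulP[x [y [xu yu ->]]]; apply: realizes_le (dlS h) _.
  by rewrite expr2; apply: realizes_mul => //; [exact: Hw|exact: Hw'].
have Titer h u m w : set_mul mul2 u u = u -> iterate T h u m w ->
    exists v, [/\ T h.+1 w v, set_mul mul2 u v = v, set_mul mul2 v u = v & set_mul mul2 v v = v].
  move=> uu I; have uB : u \in ext_belief_monoid G by case: I => {m w} [w []|v m w []].
  have ut x : x \in u -> total2 x := tot u x uB.
  exists (set_sharp mul2 sharp2 u); split.
  - split; first exact: generated_sharp.
    have [_ _ HT] := Hg _ (dlP h); apply: (HT u uB uu m).
    by apply: iterate_sub I => v [].
  - exact: (mul_set_sharp (@bmx2_mulA S) (@total2_mul S) (@total2_sharp S)
      (@bmx2_sharpL S) ut uu).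
  - exact: (set_sharp_mul (@bmx2_mulA S) (@total2_mul S) (@total2_sharp S)
      (@bmx2_sharpR S) ut uu).
  - exact: (set_sharp_idem (@bmx2_mulA S) (@total2_mul S) (@total2_sharp S)
      (@bmx2_sharpL S) (@bmx2_sharp_idem S) ut).
have Tletter a : exists u, T 0%N [:: a] u.
  exists (ext_action_belief a); split.
    by apply: generated_in; rewrite inE; apply/orP; left; exact: imset_f.
  move=> x; rewrite inE => /asboolP[tau ->]; exists tau; split.
    exact: action_supported.
  exact: Hd0.
(* A matrix of the belief with an entry from [s] outside [final G] lets Player 2 miss it with
   probability [dl H], more than the tolerated [dl H / 2]. *)
have half : 0 < dl H / 2 by rewrite divr_gt0 //; case/andP: (dlP H).
have [w Hw] := val1 _ half.
(* The factorization theorem concerns nonempty words; if the empty one is good enough, then [s] is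
   final and the identity is a witness. *)
have [w0|wn0] := pselect (w = [::]).
  exists [set bmx_one S]; first by apply: generated_in; rewrite inE finset.set11 orbT.
  move=> U t /set1P ->; rewrite ffunE /= => /eqP <-.
  have /card_gt0P[b0 _] := A2_nonempty G.
  have := Hw (fun _ _ => b0); rewrite w0 /= /kone; apply: contraTT => sF.
  rewrite big1; last by move=> t' tF; case: eqP => // st; rewrite st tF in sF.
  by rewrite -ltNge; have := dl1 H; lra.
have [u [uB Hu]] := fact _ T Tmono Tprod Titer Tletter w wn0.
exists (proj u); first exact: proj_belief.
move=> U t /projP[W UWu] Ust; apply: contraT => tF.
have [tau [_ bP]] := Hu _ UWu; have /= dP := bP _ _ Ust.
have [P0 P1] := word_kernel_stochastic w tau.
have sum1 : \sum_(i in final G) word_kernel w tau s i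
    + \sum_(i | i \notin final G) word_kernel w tau s i = 1.
  by rewrite -(P1 s) [RHS](bigID (mem (final G))).
have big : dl H <= \sum_(i | i \notin final G) word_kernel w tau s i.
  by rewrite (bigD1 t) //=; apply: le_trans dP _; rewrite lerDl sumr_ge0.
have /andP[dH0 _] := dlP H; have Hwt := Hw tau.
have /negP[] : ~~ (dl H <= dl H / 2) by rewrite -ltNge; lra.
by lra.
Qed.

End Completeness.

(** * The computed closure is the belief monoid; correctness of the algorithm *)

Lemma computed_action_beliefE (R : realType) (G : half_blind_game R) (a : A1 G) :
  computed_action_belief a = action_belief a.
Proof.
apply/setP => U; rewrite [RHS]inE; apply/imsetP/asboolP => [[sigma _ ->]|[tau ->]].
  by exists (fun _ y => sigma y).
exists [ffun y => tau 0%N y] => //; apply/ffunP => -[s t].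
by rewrite !action_bmxE; congr (_ < action_kernel _ _ _ _); apply/funext => y; rewrite ffunE.
Qed.

Lemma computed_belief_monoidE (R : realType) (G : half_blind_game R) :
  computed_belief_monoid G = belief_monoid G.
Proof.
rewrite /computed_belief_monoid saturate_generated saturate_sharpE.
by congr (generated _ _ (_ :|: _)); apply: eq_imset => a; exact: computed_action_beliefE.
Qed.

Theorem theorem4 (R : realType) (G : half_blind_game R) (s : S1 G) :
  leaktight G ->
  [/\ computed_belief_monoid G = belief_monoid G,
      belief_monoid_algorithm s <->
        (exists2 u, u \in belief_monoid G & reachability_witness s u)
    & (exists2 u, u \in belief_monoid G & reachability_witness s u) <->
        maxmin_value s = 1].
Proof.
move=> lt; split; first exact: computed_belief_monoidE.
  rewrite /belief_monoid_algorithm computed_belief_monoidE; split.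
    case/existsP => u /andP[uB /forall_inP wit]; exists u => // U t Uu.
    by move/forallP: (wit U Uu) => /(_ t)/implyP.
  case=> u uB wit; apply/existsP; exists u; rewrite uB /=.
  by apply/forall_inP => U Uu; apply/forallP => t; apply/implyP; exact: wit.
split; last exact: value_witness.
by case=> u; exact: witness_value.
Qed.
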